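(* Let $\Sigma\in\mathbb{R}^{d\times d}$ be symmetric positive definite with $(\Sigma^{-1})_{ii}=1$ for all $i=1,\dots,d$, and let $\kappa=\lambda_{\max}(\Sigma)/\lambda_{\min}(\Sigma)$. Then $$\mathbb{E}_R\Big[\inf_{q\in\mathcal{P}_{\mathrm{prod}}}\mathrm{KL}\big(q\,\|\,\mathcal{N}(0,R\Sigma R^\top)\big)\Big]\le\Big(1-\frac{2}{(d+2)\kappa^2}\Big)\,\mathrm{KL}\big(\mathcal{N}(0,I_d)\,\|\,\mathcal{N}(0,\Sigma)\big),$$ where the expectation is over $R$ drawn from the uniform (Haar) distribution on the orthogonal group $O(d)$.
   Context: $\mathcal{P}_{\mathrm{prod}}$ is the set of product probability measures on $\mathbb{R}^d$ with positive continuously differentiable densities. $\mathrm{KL}(q\|p)=\mathbb{E}_q[\log(q/p)]$. The hypothesis $(\Sigma^{-1})_{ii}=1$ is equivalent to $\mathcal{N}(0,I_d)$ being the optimal product (mean-field) approximation of $\mathcal{N}(0,\Sigma)$ in reverse KL. *)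

(* Defs.v *)
From HB Require Import structures.
From mathcomp Require Import all_boot all_order all_algebra.
From mathcomp Require Import all_classical all_reals all_analysis.
Set Implicit Arguments. Unset Strict Implicit. Unset Printing Implicit Defensive.
Import Order.TTheory GRing.Theory Num.Theory.
Import numFieldNormedType.Exports.
Local Open Scope classical_set_scope.
Local Open Scope ring_scope.

Section Defs.
Variable R : realType.

Definition upd_coord (d : nat) (v : 'rV[R]_d) (k : nat) (t : R) : 'rV[R]_d :=
  \row_i (if val i == k then t else v 0 i).

(** Iterated Lebesgue integral over the first k coordinates (Tonelli:
    for nonnegative measurable integrands it is the d-dimensional
    Lebesgue integral). *)
Fixpoint iter_int (d : nat) (k : nat) (f : 'rV[R]_d -> \bar R) (v : 'rV[R]_d)
  : \bar R :=
  match k with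
  | 0 => f v
  | k'.+1 => (\int[@lebesgue_measure R]_(t in setT)
                iter_int k' f (upd_coord v k' t))%E
  end.

Definition Rd_nnint (d : nat) (f : 'rV[R]_d -> \bar R) : \bar R :=
  iter_int d f 0.

Definition Rd_int (d : nat) (f : 'rV[R]_d -> R) : \bar R :=
  (Rd_nnint (fun x => (Num.max (f x) 0)%:E)
   - Rd_nnint (fun x => (Num.max (- f x) 0)%:E))%E.

Definition KL (d : nat) (q p : 'rV[R]_d -> R) : \bar R :=
  Rd_int (fun x => q x * ln (q x / p x)).

Definition gauss_density (d : nat) (S : 'M[R]_d) (x : 'rV[R]_d) : R :=
  (Num.sqrt ((2 * pi) ^+ d * \det S))^-1
  * expR (- ((x *m invmx S *m x^T) 0 0) / 2).

Definition C1 (f : R -> R) : Prop :=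
  (forall x : R, derivable f x 1) /\ continuous (derive1 f).

Definition Pprod (d : nat) : set ('rV[R]_d -> R) :=
  [set q | exists qs : 'I_d -> R -> R,
     (forall i x, 0 < qs i x) /\
     (forall i, C1 (qs i)) /\
     (forall i, (\int[@lebesgue_measure R]_(t in setT) (qs i t)%:E = 1)%E) /\
     q = (fun x : 'rV[R]_d => \prod_(i < d) qs i (x 0 i))].

Definition sym_pos_def (d : nat) (S : 'M[R]_d) : Prop :=
  S^T = S /\ forall x : 'rV[R]_d, x != 0 -> 0 < (x *m S *m x^T) 0 0.

Definition orthogonal_mx (d : nat) (Q : 'M[R]_d) : Prop := Q *m Q^T = 1%:M.

(** Measurable structure on d x d matrices: generated by the entries
    (i.e. the Borel sigma-algebra of R^(d*d)). *)
Definition mx_entry_sets (d : nat) : set (set 'M[R]_d) :=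
  [set A | exists (i j : 'I_d) (B : set R),
     measurable B /\ A = (fun M : 'M[R]_d => M i j) @^-1` B].

Definition MxSpace (d : nat) := g_sigma_algebraType (@mx_entry_sets d).

(** mu is the Haar (uniform) probability on O(d): concentrated on O(d) and
    invariant under left multiplication by orthogonal matrices (this
    characterizes the normalized Haar measure uniquely). *)
Definition haar_orthogonal (d : nat)
  (mu : probability (MxSpace d) R) : Prop :=
  mu [set M : MxSpace d | orthogonal_mx M] = 1%E /\
  forall (Q : 'M[R]_d), orthogonal_mx Q ->
    forall A : set (MxSpace d), measurable A ->
      mu ((fun M : MxSpace d => (Q *m M : MxSpace d)) @^-1` A) = mu A.

End Defs.

(* Main.v *)
Require Import Defs.
From HB Require Import structures.
From mathcomp Require Import all_boot all_order all_algebra.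
From mathcomp Require Import all_classical all_reals all_analysis.
From mathcomp Require Import measurable_realfun.
From mathcomp Require Import spectral complex ring lra.
Import Order.TTheory GRing.Theory Num.Theory.
Import numFieldNormedType.Exports.
Local Open Scope classical_set_scope.
Local Open Scope ring_scope.
Set Implicit Arguments.
Unset Strict Implicit.
Unset Printing Implicit Defensive.

(** Write P = S^-1 and A = Q P Q^T. The product of centred normal densities with
    variances 1 / A_ii has divergence (ln det S + sum_i ln A_ii) / 2 from
    N(0, Q S Q^T), and KL(N(0, I) || N(0, S)) = ln det S / 2 because P has unit
    diagonal. As sum_i A_ii = tr P = d, a second order bound of the logarithm on
    ]0, 1/lmin] gives sum_i ln A_ii <= - lmin^2 sum_i (A_ii - 1)^2 / 2, and on
    [1/lmax, +oo[ it gives ln det S <= lmax^2 (tr P^2 - d) / 2.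

    It remains to average sum_i A_ii^2. Invariance of the Haar measure under the
    rotation by 45 degrees in the (i, j) plane yields
    E[A_ii^2 + A_jj^2] = E[(A_ii + A_jj)^2 / 2 + 2 A_ij^2]; summing over i <> j and
    using that tr A and tr A^2 are constant gives
    (d + 2) E[sum_i A_ii^2] = (tr P)^2 + 2 tr P^2. *)

(** * Iterated integrals *)

(** Both first order terms of the logarithm cancel, because the A_ii and the inverse eigenvalues of
    S each sum to d. What remains on both sides is the single quantity t = tr P^2 - d. On average
    sum_i A_ii^2 - d equals (d^2 + 2 tr P^2) / (d + 2) - d = 2 t / (d + 2), so the product
    approximation lowers ln det S / 2 by at least lmin^2 t / (2 (d + 2)). Since t >= 2 ln det S /
    lmax^2, this gain is at least 2 / ((d + 2) kappa^2) times ln det S / 2: each of the two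
    logarithm bounds contributes the square of one extreme eigenvalue. No formula for Haar measure
    is needed: invariance alone gives a linear equation for E[sum_i A_ii^2], which can be solved
    because this expectation is finite. *)

Section IteratedIntegral.
Context {R : realType} {d : nat}.
Implicit Types (f g a b : 'rV[R]_d -> R).

(* Borel measurability on R^d, phrased so that it can be tested after any
   substitution whose coordinates are measurable: this makes Tonelli's theorem
   for [iter_int] an induction on the number of integrated coordinates. *)
Definition Rd_measurable (rd : measure_display) (T : sigmaRingType rd)
    (f : 'rV[R]_d -> T) : Prop :=
  forall (disp : measure_display) (X : measurableType disp) (phi : X -> 'rV[R]_d),
    (forall i, measurable_fun setT (fun x => phi x 0 i)) ->
    measurable_fun setT (f \o phi).

Lemma iter_int_ge0 k (f : 'rV[R]_d -> \bar R) v :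
  (forall x, 0 <= f x)%E -> (0 <= iter_int k f v)%E.
Proof.
move=> f0; elim: k v => [|k IH] v //=.
by apply: integral_ge0 => t _; exact: IH.
Qed.

(** The induction hypothesis is applied on the larger space [X * R], whose second component feeds
    the coordinate about to be integrated; Tonelli then gives measurability of the partial integral
    in the first component. *)
Lemma iter_int_measurable k (f : 'rV[R]_d -> \bar R) :
  (forall x, 0 <= f x)%E -> Rd_measurable f -> Rd_measurable (iter_int k f).
Proof.
move=> f0 mf; elim: k => [|k IH] //= disp X phi mphi.
pose psi (p : X * R) := upd_coord (phi p.1) k p.2.
have mpsi i : measurable_fun setT (fun p => psi p 0 i).
  have -> : (fun p => psi p 0 i) =
      (fun p => if val i == k then p.2 else phi p.1 0 i).
    by apply/funext => p; rewrite mxE.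
  case: (val i == k); first exact: measurable_snd.
  exact: (measurableT_comp (mphi i) measurable_fst).
apply: (@measurable_fun_fubini_tonelli_F _ _ _ _ _ (@lebesgue_measure R)
  (iter_int k f \o psi)); first exact: IH.
by move=> p /=; exact: iter_int_ge0.
Qed.

Lemma iter_int_upd_measurable k (f : 'rV[R]_d -> \bar R) j v :
  (forall x, 0 <= f x)%E -> Rd_measurable f ->
  measurable_fun setT (fun t => iter_int k f (upd_coord v j t)).
Proof.
move=> f0 mf.
apply: (iter_int_measurable k f0 mf (phi := fun t => upd_coord v j t)) => i.
have -> : (fun t => upd_coord v j t 0 i) =
    (fun t => if val i == j then t else v 0 i) by apply/funext => t; rewrite mxE.
by case: (val i == j); [exact: measurable_id|exact: measurable_cst].
Qed.

Lemma iter_intD k (f g : 'rV[R]_d -> \bar R) v :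
  (forall x, 0 <= f x)%E -> Rd_measurable f ->
  (forall x, 0 <= g x)%E -> Rd_measurable g ->
  iter_int k (fun x => f x + g x)%E v = (iter_int k f v + iter_int k g v)%E.
Proof.
move=> f0 mf g0 mg; elim: k v => [|k IH] v //=.
under eq_integral do rewrite IH.
rewrite ge0_integralD//.
- by move=> t _; exact: iter_int_ge0.
- exact: iter_int_upd_measurable.
- by move=> t _; exact: iter_int_ge0.
- exact: iter_int_upd_measurable.
Qed.

Lemma iter_intZ k (f : 'rV[R]_d -> \bar R) (c : R) v : 0 <= c ->
  (forall x, 0 <= f x)%E -> Rd_measurable f ->
  iter_int k (fun x => c%:E * f x)%E v = (c%:E * iter_int k f v)%E.
Proof.
move=> c0 f0 mf; elim: k v => [|k IH] v //=.
under eq_integral do rewrite IH.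
rewrite ge0_integralZl_EFin//.
- by move=> t _; exact: iter_int_ge0.
- exact: iter_int_upd_measurable.
Qed.

Lemma iter_int_prod k (fs : 'I_d -> R -> R) (Is : 'I_d -> R) v : (k <= d)%N ->
  (forall i t, 0 <= fs i t) -> (forall i, measurable_fun setT (fs i)) ->
  (forall i, \int[@lebesgue_measure R]_t (fs i t)%:E = (Is i)%:E)%E ->
  iter_int k (fun x => (\prod_(i < d) fs i (x 0 i))%:E) v =
  (\prod_(i < d) if (i < k)%N then Is i else fs i (v 0 i))%:E.
Proof.
move=> + fs0 mfs Ifs.
have Is0 i : 0 <= Is i.
  by rewrite -lee_fin -Ifs; apply: integral_ge0 => t _; rewrite lee_fin.
elim: k v => [|k IH] v kd //=.
pose j := Ordinal kd.
(* Collects the factors that do not involve the coordinate being integrated. Away from [j], whose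
   index is [k], the tests [i < k] and [i < k.+1] agree. *)
pose C : R := \prod_(i < d | i != j) (if (i < k.+1)%N then Is i else fs i (v 0 i)).
have C0 : 0 <= C by apply: prodr_ge0 => i _; case: ifP.
transitivity (\int[@lebesgue_measure R]_t (C%:E * (fs j t)%:E))%E.
  apply: eq_integral => t _.
  rewrite IH ?(ltnW kd)// (bigD1 j)//= ltnn mxE eqxx mulrC EFinM; congr (_%:E * _)%E.
  apply: eq_bigr => i ij; rewrite ltnS [in RHS]leq_eqVlt mxE /=.
  have -> // : (nat_of_ord i == k) = false.
  by apply: contraNF ij => /eqP ik; apply/eqP/val_inj.
rewrite ge0_integralZl_EFin//; first last.
- by apply/measurable_EFinP; exact: mfs.
- by move=> t _; rewrite lee_fin.
by rewrite Ifs -EFinM (bigD1 j)//= ltnSn mulrC.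
Qed.

(* Any splitting of [f] into nonnegative parts is allowed, not only the positive
   and negative parts used by [Rd_int]: this makes linearity immediate. *)
Definition Rd_has_int f (r : R) : Prop :=
  exists a b (ra rb : R),
    [/\ (forall x, 0 <= a x) /\ Rd_measurable a,
        (forall x, 0 <= b x) /\ Rd_measurable b,
        Rd_nnint (EFin \o a) = ra%:E /\ Rd_nnint (EFin \o b) = rb%:E,
        forall x, f x = a x - b x & r = ra - rb].

Lemma Rd_measurable_EFin f : Rd_measurable f -> Rd_measurable (EFin \o f).
Proof. by move=> mf disp X phi mphi; apply/measurable_EFinP; exact: mf. Qed.

Lemma Rd_measurableD f g : Rd_measurable f -> Rd_measurable g ->
  Rd_measurable (fun x => f x + g x).
Proof.
by move=> mf mg disp X phi mphi; apply: measurable_funD; [exact: mf|exact: mg].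
Qed.

Lemma Rd_measurableB f g : Rd_measurable f -> Rd_measurable g ->
  Rd_measurable (fun x => f x - g x).
Proof.
by move=> mf mg disp X phi mphi; apply: measurable_funB; [exact: mf|exact: mg].
Qed.

Lemma Rd_measurableZ c f : Rd_measurable f -> Rd_measurable (fun x => c * f x).
Proof.
move=> mf disp X phi mphi; apply: measurable_funM; last exact: mf.
exact: measurable_cst.
Qed.

Lemma Rd_nnintD f g : (forall x, 0 <= f x) -> Rd_measurable f ->
  (forall x, 0 <= g x) -> Rd_measurable g ->
  Rd_nnint (fun x => (f x + g x)%:E) =
  (Rd_nnint (EFin \o f) + Rd_nnint (EFin \o g))%E.
Proof.
move=> f0 mf g0 mg; rewrite /Rd_nnint -iter_intD//;
  try exact: Rd_measurable_EFin; by move=> x; rewrite lee_fin.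
Qed.

(** The positive part [fp] is the least nonnegative minuend, so [a] exceeds it by a nonnegative
    [am], and finiteness of the integral of [a] passes to [fp]. Integrating [fn + a = fp + b] then
    gives the value without ever subtracting infinities. *)
Lemma Rd_has_intE f r : Rd_has_int f r -> Rd_int f = r%:E.
Proof.
move=> [a [b [ra [rb [[a0 ma] [b0 mb] [Na Nb] fE ->]]]]]; rewrite /Rd_int.
have mf : Rd_measurable f.
  by rewrite (funext fE); exact: Rd_measurableB.
pose fp x := Num.max (f x) 0; pose fn x : R := Num.max (- f x) 0; pose am x : R := a x - fp x.
have mp : Rd_measurable fp.
  move=> disp X phi mphi; apply: measurable_maxr; first exact: mf.
  exact: measurable_cst.
have mn : Rd_measurable fn.
  move=> disp X phi mphi; apply: measurable_maxr; last exact: measurable_cst.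
  by apply: measurableT_comp => //; exact: mf.
have p0 x : 0 <= fp x by rewrite le_max lexx orbT.
have n0 x : 0 <= fn x by rewrite le_max lexx orbT.
have nE x : fn x = fp x - f x.
  rewrite /fn /fp; have [f0|f0] := leP 0 (f x).
    by rewrite max_r ?oppr_le0 ?subrr.
  by rewrite max_l ?sub0r// oppr_ge0 ltW.
have pa x : 0 <= am x.
  rewrite /am subr_ge0 /fp ge_max a0 andbT fE lerBlDr.
  by rewrite lerDl.
have N1 := Rd_nnintD p0 mp pa (Rd_measurableB ma mp).
have N2 := Rd_nnintD n0 mn a0 ma.
have N3 := Rd_nnintD p0 mp b0 mb.
have E1 : (fun x => (fp x + am x)%:E) = EFin \o a.
  by apply/funext => x /=; rewrite /am addrC subrK.
have E2 : (fun x => (fn x + a x)%:E) = (fun x => (fp x + b x)%:E).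
  by apply/funext => x; rewrite nE fE; congr EFin; lra.
rewrite E1 Na in N1; rewrite E2 N3 Na Nb in N2.
rewrite -/(EFin \o fp) -/(EFin \o fn).
change (Rd_nnint (EFin \o fp) - Rd_nnint (EFin \o fn) = (ra - rb)%:E)%E.
have P0 : (0 <= Rd_nnint (EFin \o fp))%E.
  by apply: iter_int_ge0 => x; rewrite lee_fin.
have Q0 : (0 <= Rd_nnint (EFin \o am))%E.
  by apply: iter_int_ge0 => x; rewrite lee_fin.
have M0 : (0 <= Rd_nnint (EFin \o fn))%E.
  by apply: iter_int_ge0 => x; rewrite lee_fin.
move: N1 N2 P0 Q0 M0.
case: (Rd_nnint (EFin \o fp)) => [p| |] //;
case: (Rd_nnint (EFin \o am)) => [q| |] //;
case: (Rd_nnint (EFin \o fn)) => [n| |] // _.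
by rewrite -!EFinD => -[] H _ _ _; congr EFin; lra.
Qed.

Lemma Rd_has_intD f g r s : Rd_has_int f r -> Rd_has_int g s ->
  Rd_has_int (fun x => f x + g x) (r + s).
Proof.
move=> [a [b [ra [rb [[a0 ma] [b0 mb] [Na Nb] fE ->]]]]].
move=> [a' [b' [ra' [rb' [[a'0 ma'] [b'0 mb'] [Na' Nb'] gE ->]]]]].
exists (fun x => a x + a' x), (fun x => b x + b' x), (ra + ra'), (rb + rb').
split.
- by split; [move=> x; exact: addr_ge0|exact: Rd_measurableD].
- by split; [move=> x; exact: addr_ge0|exact: Rd_measurableD].
- by split; [rewrite Rd_nnintD// Na Na'|rewrite Rd_nnintD// Nb Nb'].
- by move=> x; rewrite fE gE; lra.
- lra.
Qed.

Lemma Rd_nnintZ c f : 0 <= c -> (forall x, 0 <= f x) -> Rd_measurable f ->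
  Rd_nnint (fun x => (c * f x)%:E) = (c%:E * Rd_nnint (EFin \o f))%E.
Proof.
move=> c0 f0 mf; rewrite /Rd_nnint -iter_intZ//; exact: Rd_measurable_EFin.
Qed.

Lemma Rd_measurable0 : Rd_measurable (fun=> 0 : R).
Proof. by move=> disp X phi _; exact: measurable_cst. Qed.

Lemma Rd_nnint0 : @Rd_nnint R d (EFin \o (fun=> 0)) = 0%:E.
Proof.
have := Rd_nnintZ (lexx 0) (fun=> lexx 0) Rd_measurable0; rewrite mul0e => H.
by rewrite -[RHS]H; congr Rd_nnint; apply/funext => x /=; rewrite mul0r.
Qed.

Lemma Rd_has_intN f r : Rd_has_int f r -> Rd_has_int (fun x => - f x) (- r).
Proof.
move=> [a [b [ra [rb [ha hb [Na Nb] fE ->]]]]].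
by exists b, a, rb, ra; split => // [x|]; rewrite ?fE opprB.
Qed.

Lemma Rd_has_intZ c f r : Rd_has_int f r -> Rd_has_int (fun x => c * f x) (c * r).
Proof.
wlog c0 : c / 0 <= c => [H hf|].
  have [c0|/ltW c0] := leP 0 c; first exact: H.
  have Nc0 : 0 <= - c by rewrite oppr_ge0.
  have := Rd_has_intN (H (- c) Nc0 hf); rewrite mulNr opprK.
  by congr Rd_has_int; apply/funext => x; rewrite mulNr opprK.
move=> [a [b [ra [rb [[a0 ma] [b0 mb] [Na Nb] fE ->]]]]].
exists (fun x => c * a x), (fun x => c * b x), (c * ra), (c * rb); split.
- by split; [move=> x; exact: mulr_ge0|exact: Rd_measurableZ].
- by split; [move=> x; exact: mulr_ge0|exact: Rd_measurableZ].
- by split; [rewrite Rd_nnintZ// Na|rewrite Rd_nnintZ// Nb].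
- by move=> x; rewrite fE; lra.
- lra.
Qed.

Lemma Rd_has_int0 : Rd_has_int (fun=> 0) 0.
Proof.
have N0 := Rd_nnint0.
exists (fun=> 0), (fun=> 0), 0, 0; split; rewrite ?subr0//.
- by split=> //; exact: Rd_measurable0.
- by split=> //; exact: Rd_measurable0.
Qed.

Lemma Rd_has_int_sum (I : Type) (s : seq I) (F : I -> 'rV[R]_d -> R) (r : I -> R) :
  (forall i, Rd_has_int (F i) (r i)) ->
  Rd_has_int (fun x => \sum_(i <- s) F i x) (\sum_(i <- s) r i).
Proof.
move=> hF; elim: s => [|i s IH].
  rewrite big_nil (_ : (fun x => _) = fun=> 0); first exact: Rd_has_int0.
  by apply/funext => x; rewrite big_nil.
rewrite big_cons (_ : (fun x => _) = fun x => F i x + \sum_(j <- s) F j x).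
  exact: Rd_has_intD.
by apply/funext => x; rewrite big_cons.
Qed.

Lemma Rd_has_int_prod (fs : 'I_d -> R -> R) (Is : 'I_d -> R) :
  (forall i t, 0 <= fs i t) -> (forall i, measurable_fun setT (fs i)) ->
  (forall i, \int[@lebesgue_measure R]_t (fs i t)%:E = (Is i)%:E)%E ->
  Rd_has_int (fun x => \prod_(i < d) fs i (x 0 i)) (\prod_(i < d) Is i).
Proof.
move=> fs0 mfs Ifs.
have N0 := Rd_nnint0.
exists (fun x => \prod_(i < d) fs i (x 0 i)), (fun=> 0), (\prod_(i < d) Is i), 0.
split=> //; last by rewrite subr0.
- split; first by move=> x; apply: prodr_ge0.
  move=> disp X phi mphi; apply: measurable_prod => i _.
  exact: measurableT_comp (mfs i) (mphi i).
- by split=> //; exact: Rd_measurable0.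
- split=> //; rewrite /Rd_nnint (@iter_int_prod _ fs Is)//.
  by congr EFin; apply: eq_bigr => i _; rewrite ltn_ord.
- by move=> x; rewrite subr0.
Qed.

End IteratedIntegral.

(** * Moments of the normal density *)

Section GaussianMoments.
Context {R : realType} (s : R).
Context (s_gt0 : 0 < s).
Local Notation mu := (@lebesgue_measure R).
Local Notation phi := (normal_pdf 0 s).

Lemma normal_pdf0E x : phi x = normal_peak s * expR (- (2 * s ^+ 2)^-1 * x ^+ 2).
Proof.
rewrite normal_pdfE ?gt_eqF// /normal_fun subr0; congr (_ * expR _).
by rewrite mulr_natl mulrC mulrN mulNr.
Qed.

Lemma normal_pdf0_gt0 x : 0 < phi x.
Proof. by rewrite normal_pdf0E mulr_gt0 ?expR_gt0// normal_peak_gt0// gt_eqF. Qed.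

Lemma is_derive_normal_pdf0 (x : R) : is_derive x 1 (phi : R -> R) (- (s ^+ 2)^-1 * x * phi x).
Proof.
have -> : phi = (fun x => normal_peak s * expR (- (2 * s ^+ 2)^-1 * x ^+ 2)).
  by apply/funext => y; rewrite normal_pdf0E.
apply: is_derive_eq; rewrite /GRing.scale /=.
by field; rewrite gt_eqF.
Qed.

Lemma C1_normal_pdf0 : C1 phi.
Proof.
split=> [x|]; first by have [] := is_derive_normal_pdf0 x.
have -> : derive1 phi = (fun x => - (s ^+ 2)^-1 * x * phi x).
  by apply/funext => x; rewrite derive1E; have [_ ->] := is_derive_normal_pdf0 x.
move=> x; apply: cvgM; last by apply: continuous_normal_pdf; rewrite gt_eqF.
by apply: cvgM; [exact: cvg_cst|exact: cvg_id].
Qed.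

(** From y <= exp y with y = x^2 / (2 s^2), the product is at most [c / x], where [c] is the peak
    times 2 s^2. *)
Lemma mulr_normal_pdf0_cvg0 : x * phi x @[x --> +oo] --> (0 : R).
Proof.
pose c := normal_peak s * (2 * s ^+ 2).
apply: (@squeeze_cvgr _ _ _ _ (fun=> 0) (fun x => c * x^-1)).
- near=> x.
  have x0 : 0 < x by near: x; exact: nbhs_pinfty_gt.
  rewrite mulr_ge0 ?(ltW x0) ?(ltW (normal_pdf0_gt0 x))//=.
  rewrite normal_pdf0E /c mulrCA -mulrA.
  rewrite ler_wpM2l ?normal_peak_ge0// mulNr expRN ler_pdivrMr ?expR_gt0//.
  have y0 : 0 < (2 * s ^+ 2)^-1 * x ^+ 2.
    by rewrite mulr_gt0 ?invr_gt0 ?mulr_gt0 ?exprn_gt0.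
  have h : (2 * s ^+ 2)^-1 * x ^+ 2 <= expR ((2 * s ^+ 2)^-1 * x ^+ 2).
    by apply: le_trans (expR_ge1Dx _); rewrite lerDr.
  apply: le_trans (ler_wpM2l _ h); last first.
    by rewrite mulr_ge0 ?invr_ge0 ?(ltW x0)// mulr_ge0 ?sqr_ge0.
  by rewrite le_eqVlt; apply/orP; left; apply/eqP; field; rewrite !gt_eqF.
- exact: cvg_cst.
- rewrite -[X in _ --> X](mulr0 c); apply: cvgM; first exact: cvg_cst.
  apply/gtr0_cvgV0; last exact: cvg_id.
  exact: nbhs_pinfty_gt.
Unshelve. all: by end_near. Qed.

Lemma normal_pdf0_cvg0 : phi x @[x --> +oo] --> (0 : R).
Proof.
apply: (@squeeze_cvgr _ _ _ _ (fun=> 0) (fun x => x * phi x)).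
- near=> x; rewrite (ltW (normal_pdf0_gt0 x))/=.
  by rewrite ler_peMl ?(ltW (normal_pdf0_gt0 x))//; near: x; exact: nbhs_pinfty_ge.
- exact: cvg_cst.
- exact: mulr_normal_pdf0_cvg0.
Unshelve. all: by end_near. Qed.

Lemma continuous_mul_normal_pdf0 (p : R -> R) : continuous p ->
  continuous (fun x => p x * phi x).
Proof.
move=> cp x; apply: cvgM; first exact: cp.
by apply: continuous_normal_pdf; rewrite gt_eqF.
Qed.

Let F (x : R) : R := - (s ^+ 2) * (x * phi x).

Let dF (x : R) : is_derive x 1 F ((x ^+ 2 - s ^+ 2) * phi x).
Proof.
have H := is_derive_normal_pdf0 x.
apply: is_derive_eq; rewrite /GRing.scale /=.
by field; rewrite gt_eqF.
Qed.

Let F'E : F^`()%classic = (fun x => (x ^+ 2 - s ^+ 2) * phi x).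
Proof. by apply/funext => x; rewrite derive1E; have [_ ->] := dF x. Qed.

Let cF : continuous F.
Proof.
move=> x; apply: cvgM; first exact: cvg_cst.
by apply: (@continuous_mul_normal_pdf0 id) => // y; exact: cvg_id.
Qed.

Let csqr : continuous (fun x : R => x ^+ 2).
Proof. exact: sqr_continuous. Qed.

Let mp (p : R -> R) : continuous p -> measurable_fun setT (fun x => (p x * phi x)%:E).
Proof.
move=> cp; apply/measurable_EFinP; apply: continuous_measurable_fun.
exact: continuous_mul_normal_pdf0.
Qed.

Let csqrB : continuous (fun x : R => x ^+ 2 - s ^+ 2).
Proof. by move=> x; apply: cvgB; [exact: csqr|exact: cvg_cst]. Qed.

(** The value is - F(s), the boundary term at infinity being 0. It coincides with the one in
    [int_head]: the excess of x^2 over s^2 beyond [s] balances the deficit before [s]. *)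
Let int_tail : (\int[mu]_(x in `[s, +oo[) ((x ^+ 2 - s ^+ 2) * phi x)%:E =
  (s ^+ 3 * phi s)%:E)%E.
Proof.
rewrite (@ge0_continuous_FTC2y _ _ F s 0).
- by rewrite sub0e /F -EFinN; congr EFin; ring.
- move=> x sx; rewrite mulr_ge0 ?(ltW (normal_pdf0_gt0 x))// subr_ge0.
  by rewrite lerXn2r ?nnegrE ?(ltW s_gt0) ?(le_trans (ltW s_gt0) sx).
- by apply: continuous_subspaceT => x; exact: continuous_mul_normal_pdf0.
- rewrite -[X in _ --> X](mulr0 (- (s ^+ 2))).
  apply: cvgM; [exact: cvg_cst|exact: mulr_normal_pdf0_cvg0].
- by move=> x _; have [] := dF x.
- exact/cvg_at_right_filter/cF.
- by move=> x _; rewrite F'E.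
Qed.

Let csqrB' : continuous (fun x : R => s ^+ 2 - x ^+ 2).
Proof. by move=> x; apply: cvgB; [exact: cvg_cst|exact: csqr]. Qed.

Let int_head : (\int[mu]_(x in `[0%R, s]) ((s ^+ 2 - x ^+ 2) * phi x)%:E =
  (s ^+ 3 * phi s)%:E)%E.
Proof.
rewrite (@continuous_FTC2 _ _ (fun x => - F x) 0 s)//.
- by rewrite /F mul0r mulr0 oppr0 sube0; congr EFin; ring.
- by apply: continuous_subspaceT => x; exact: continuous_mul_normal_pdf0.
- split=> [x _||].
  + by apply: derivableN; have [] := dF x.
  + by apply: cvgN; exact/cvg_at_right_filter/cF.
  + by apply: cvgN; exact/cvg_at_left_filter/cF.
- move=> x _; rewrite derive1E deriveN; last by have [] := dF x.
  by have [_ ->] := dF x; rewrite -mulNr opprB.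
Qed.

Let ge0_phi (c x : R) : 0 <= c -> (0 <= (c * phi x)%:E)%E.
Proof. by move=> p0; rewrite lee_fin mulr_ge0 ?(ltW (normal_pdf0_gt0 x)). Qed.

(* [(x^2 - s^2) phi] is the derivative of [- s^2 x phi]; it is integrated
   separately on both sides of its sign change at [s]. *)
Let int_half : (\int[mu]_(x in `[0%R, +oo[) (x ^+ 2 * phi x)%:E =
  \int[mu]_(x in `[0%R, +oo[) (s ^+ 2 * phi x)%:E)%E.
Proof.
have U : `[0%R, +oo[%classic = `[0%R, s[%classic `|` `[s, +oo[%classic :> set R.
  apply/seteqP; split=> x /=; rewrite !in_itv /= ?andbT.
    by move=> x0; have [xs|sx] := ltP x s; [left; rewrite x0|right].
  by move=> [/andP[]//|]; apply: le_trans; exact: ltW.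
have disj : [disjoint `[0%R, s[%classic & (`[s, +oo[%classic : set R)].
  apply/disj_setPS => x [] /=; rewrite !in_itv /= andbT => /andP[_ xs] sx.
  by move: (lt_le_trans xs sx); rewrite ltxx.
have ccst : continuous (fun _ : R => s ^+ 2) by move=> x; exact: cvg_cst.
have split (p : R -> R) : continuous p -> (forall x, 0 <= p x) ->
  (\int[mu]_(x in `[0%R, +oo[) (p x * phi x)%:E =
   \int[mu]_(x in `[0%R, s]) (p x * phi x)%:E +
   \int[mu]_(x in `[s, +oo[) (p x * phi x)%:E)%E.
  move=> cp p0; rewrite U ge0_integral_setU//=.
  - congr (_ + _)%E; apply: integral_itv_bndo_bndc.
    by apply: measurable_funTS; exact: mp.
  - by apply: measurable_funTS; exact: mp.
  - by move=> x _; exact: ge0_phi.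
rewrite split//; last by move=> x; exact: sqr_ge0.
rewrite [RHS]split//; last by move=> x; exact: sqr_ge0.
have -> : (\int[mu]_(x in `[0%R, s]) (s ^+ 2 * phi x)%:E =
    (s ^+ 3 * phi s)%:E + \int[mu]_(x in `[0%R, s]) (x ^+ 2 * phi x)%:E)%E.
  rewrite -int_head -ge0_integralD//=.
  - by apply: eq_integral => x _; rewrite -EFinD; congr EFin; ring.
  - move=> x; rewrite in_itv /= => /andP[x0 xs]; apply: ge0_phi.
    by rewrite subr_ge0 lerXn2r ?nnegrE ?(ltW s_gt0).
  - by apply: measurable_funTS; exact: mp.
  - by move=> x _; apply: ge0_phi; exact: sqr_ge0.
  - by apply: measurable_funTS; exact: mp.
have -> : (\int[mu]_(x in `[s, +oo[) (x ^+ 2 * phi x)%:E =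
    (s ^+ 3 * phi s)%:E + \int[mu]_(x in `[s, +oo[) (s ^+ 2 * phi x)%:E)%E.
  rewrite -int_tail -ge0_integralD//=.
  - by apply: eq_integral => x _; rewrite -EFinD; congr EFin; ring.
  - move=> x; rewrite in_itv /= andbT => sx; apply: ge0_phi.
    by rewrite subr_ge0 lerXn2r ?nnegrE ?(ltW s_gt0) ?(le_trans (ltW s_gt0) sx).
  - by apply: measurable_funTS; exact: mp.
  - by move=> x _; apply: ge0_phi; exact: sqr_ge0.
  - by apply: measurable_funTS; exact: mp.
by rewrite addeCA addeA.
Qed.

Let phiN x : phi (- x) = phi x.
Proof. by rewrite !normal_pdf0E sqrrN. Qed.

(** By evenness it suffices to integrate over the half line, where x^2 may be traded for the
    constant s^2; the total mass 1 concludes. *)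
Lemma normal_second_moment : (\int[mu]_x (x ^+ 2 * phi x)%:E = (s ^+ 2)%:E)%E.
Proof.
have ccst : continuous (fun _ : R => s ^+ 2) by move=> x; exact: cvg_cst.
rewrite (@ge0_symfun_integralT _ (fun x => x ^+ 2 * phi x)).
- rewrite -set_itvcy int_half set_itvcy.
  rewrite -(@ge0_symfun_integralT _ (fun x => s ^+ 2 * phi x)).
  + under eq_integral do rewrite EFinM.
    rewrite ge0_integralZl_EFin ?sqr_ge0//.
    * by rewrite integral_normal_pdf mule1.
    * by move=> x _; rewrite lee_fin ltW ?normal_pdf0_gt0.
    * by apply/measurable_EFinP; exact: measurable_normal_pdf.
  + by move=> x; rewrite -lee_fin; apply: ge0_phi; exact: sqr_ge0.
  + exact: continuous_mul_normal_pdf0.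
  + by move=> x /=; rewrite phiN.
- by move=> x; rewrite -lee_fin; apply: ge0_phi; exact: sqr_ge0.
- exact: continuous_mul_normal_pdf0.
- by move=> x /=; rewrite phiN sqrrN.
Qed.

Let int_abs_half : (\int[mu]_(x in `[0%R, +oo[) (`|x| * phi x)%:E =
  (s ^+ 2 * phi 0)%:E)%E.
Proof.
rewrite (@ge0_continuous_FTC2y _ _ (fun x => - (s ^+ 2) * phi x) 0 0).
- by rewrite sub0e -EFinN; congr EFin; ring.
- by move=> x _; rewrite -lee_fin; apply: ge0_phi.
- apply: continuous_subspaceT => x; apply: continuous_mul_normal_pdf0.
  exact: norm_continuous.
- rewrite -[X in _ --> X](mulr0 (- (s ^+ 2))).
  apply: cvgM; [exact: cvg_cst|exact: normal_pdf0_cvg0].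
- move=> x _; apply: derivableM; first exact: derivable_cst.
  by have [] := is_derive_normal_pdf0 x.
- apply: cvg_at_right_filter; apply: cvgM; first exact: cvg_cst.
  by apply: continuous_normal_pdf; rewrite gt_eqF.
- move=> x; rewrite in_itv /= andbT => x0; rewrite derive1E.
  have H := is_derive_normal_pdf0 x.
  have [_ ->] : is_derive x 1 (fun x => - (s ^+ 2) * phi x) (x * phi x).
    by apply: is_derive_eq; rewrite /GRing.scale /=; field; rewrite gt_eqF.
  by rewrite ger0_norm// ltW.
Qed.

(** Replaces the vanishing of the mean: the product formula for iterated integrals accepts
    nonnegative factors only, so the two signs are kept apart. The second integral is obtained by
    subtracting the first from that of [|x| * phi x]. *)
Lemma normal_half_moment : exists m : R,
  (\int[mu]_x (Num.max x 0 * phi x)%:E = m%:E)%E /\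
  (\int[mu]_x (Num.max (- x) 0 * phi x)%:E = m%:E)%E.
Proof.
exists (s ^+ 2 * phi 0).
have Epos : (\int[mu]_x (Num.max x 0 * phi x)%:E = (s ^+ 2 * phi 0)%:E)%E.
  rewrite -int_abs_half [RHS]integral_mkcond; apply: eq_integral => x _.
  rewrite patchE; case: ifPn => [|]; rewrite ?inE ?notin_setE /= in_itv /= andbT.
    by move=> x0; rewrite max_l// ger0_norm.
  by move/negP; rewrite -ltNge => /ltW x0; rewrite max_r// mul0r.
split=> //.
have cabs : continuous (fun x => `|x| * phi x).
  by apply: continuous_mul_normal_pdf0 => x; exact: norm_continuous.
have : (\int[mu]_x (`|x| * phi x)%:E = 2%:E * (s ^+ 2 * phi 0)%:E)%E.
  rewrite -int_abs_half set_itvcy.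
  apply: (@ge0_symfun_integralT _ (fun x => `|x| * phi x)) => // x.
    by rewrite mulr_ge0 ?(ltW (normal_pdf0_gt0 x)).
  by rewrite /= normrN phiN.
have cmax (q : R -> R) : continuous q -> continuous (fun x => Num.max (q x) 0).
  move=> cq x; apply: continuous_max; [exact: cq|exact: cvg_cst].
have -> : (\int[mu]_x (`|x| * phi x)%:E = \int[mu]_x (Num.max x 0 * phi x)%:E +
    \int[mu]_x (Num.max (- x) 0 * phi x)%:E)%E.
  rewrite -ge0_integralD//=.
  - apply: eq_integral => x _; rewrite -EFinD -mulrDl; congr (_ * _)%:E.
    have [x0|/ltW x0] := leP 0 x; first by rewrite ger0_norm ?max_r ?addr0 ?oppr_le0.
    by rewrite ler0_norm// max_l ?add0r ?oppr_ge0.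
  - by move=> x _; apply: ge0_phi; rewrite le_max lexx orbT.
  - by apply: mp; apply: (cmax id) => x; exact: cvg_id.
  - by move=> x _; apply: ge0_phi; rewrite le_max lexx orbT.
  - by apply: mp; apply: (cmax -%R) => x; exact: opp_continuous.
rewrite Epos; case: (\int[mu]_x _)%E => [r| |]//.
by rewrite -EFinD -EFinM => -[] h; congr EFin; lra.
Qed.

End GaussianMoments.

(** * Divergence between Gaussians *)

Section GaussianDensity.
Context {R : realType}.

Lemma ln_sqrt (x : R) : 0 < x -> ln (Num.sqrt x) = 2^-1 * ln x.
Proof. by move=> x0; rewrite -powR12_sqrt ?ltW// ln_powR. Qed.

(** With every density a single exponential, the logarithm of a ratio of densities becomes a
    difference of exponents. *)
Lemma normal_pdf0_expR (s t : R) : 0 < s -> normal_pdf 0 s t =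
  expR (- 2^-1 * (ln (2 * pi) + ln (s ^+ 2)) - 2^-1 * (s ^+ 2)^-1 * t ^+ 2).
Proof.
move=> s_gt0; have s2 : 0 < s ^+ 2 by rewrite exprn_gt0.
have tp : 0 < 2 * pi :> R by rewrite mulr_gt0 ?pi_gt0.
rewrite normal_pdf0E// expRD; congr (_ * _); last first.
  by congr expR; field; rewrite gt_eqF.
rewrite /normal_peak -lnM ?posrE// mulNr expRN; congr (_^-1).
have -> : s ^+ 2 * pi *+ 2 = 2 * pi * s ^+ 2 by rewrite -mulr_natl; ring.
by rewrite -ln_sqrt ?lnK ?posrE ?sqrtr_gt0// mulr_gt0.
Qed.

Lemma gauss_density_expR (d : nat) (S : 'M[R]_d) x : 0 < \det S ->
  gauss_density S x = expR (- 2^-1 * (d%:R * ln (2 * pi) + ln (\det S))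
     - 2^-1 * (x *m invmx S *m x^T) 0 0).
Proof.
move=> S0; have tp : 0 < 2 * pi :> R by rewrite mulr_gt0 ?pi_gt0.
rewrite /gauss_density expRD; congr (_ * _); last by congr expR; ring.
rewrite mulNr expRN; congr (_^-1).
rewrite [d%:R * _]mulr_natl -lnXn// -lnM ?posrE ?exprn_gt0// -ln_sqrt ?mulr_gt0 ?exprn_gt0//.
by rewrite lnK// posrE sqrtr_gt0 mulr_gt0 ?exprn_gt0.
Qed.

End GaussianDensity.

Definition normal_prod (R : realType) (d : nat) (s : 'I_d -> R) (x : 'rV[R]_d) : R :=
  \prod_(i < d) normal_pdf 0 (s i) (x 0 i).

Section GaussianKL.
Context {R : realType} {d : nat} (s : 'I_d -> R).
Context (s_gt0 : forall i, 0 < s i).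
Local Notation mu := (@lebesgue_measure R).
Local Notation q := (normal_prod s).

Lemma normal_prod_has_int (w : 'I_d -> R -> R) (c : 'I_d -> R) :
  (forall k t, 0 <= w k t) -> (forall k, measurable_fun setT (w k)) ->
  (forall k, \int[mu]_t (w k t * normal_pdf 0 (s k) t)%:E = (c k)%:E)%E ->
  Rd_has_int (fun x => q x * \prod_(k < d) w k (x 0 k)) (\prod_(k < d) c k).
Proof.
move=> w0 mw wc.
rewrite (_ : (fun x => _) =
    fun x : 'rV[R]_d => \prod_(k < d) (w k (x 0 k) * normal_pdf 0 (s k) (x 0 k))); last first.
  by apply/funext => x; rewrite big_split /= mulrC.
apply: (@Rd_has_int_prod _ _ (fun k t => w k t * normal_pdf 0 (s k) t)) => //.
- by move=> k t; rewrite mulr_ge0 ?normal_pdf_ge0.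
- by move=> k; apply: measurable_funM => //; exact: measurable_normal_pdf.
Qed.

Lemma normal_prod_has_int1 : Rd_has_int q 1.
Proof.
have := @normal_prod_has_int (fun _ _ => 1) (fun=> 1).
rewrite !big1_eq => H; move: (H (fun _ _ => ler01) (fun=> measurable_cst _ )).
rewrite (_ : (fun x : 'rV[R]_d => _ * _) = q); last first.
  by apply/funext => x; rewrite mulr1.
apply=> k; under eq_integral do rewrite mul1r; exact: integral_normal_pdf.
Qed.

Lemma normal_prod_has_int_sqr i :
  Rd_has_int (fun x => q x * (x 0 i * x 0 i)) (s i ^+ 2).
Proof.
have := @normal_prod_has_int (fun k t => if k == i then t ^+ 2 else 1)
  (fun k => if k == i then s i ^+ 2 else 1).
rewrite -big_mkcond big_pred1_eq.
rewrite (_ : (fun x : 'rV[R]_d => _ * _) = (fun x => q x * (x 0 i * x 0 i))); last first.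
  by apply/funext => x; rewrite -big_mkcond big_pred1_eq expr2.
apply.
- by move=> k t; case: ifP => // _; exact: sqr_ge0.
- by move=> k; case: (k == i) => //; exact: exprn_measurable.
- move=> k; have [->|ki] := eqVneq k i; first exact: normal_second_moment.
  under eq_integral do rewrite mul1r; exact: integral_normal_pdf.
Qed.

Lemma big_if2 (A B : 'I_d -> R) i j : i != j ->
  \prod_(k < d) (if k == i then A k else if k == j then B k else 1) = A i * B j.
Proof.
move=> ij; rewrite (bigD1 i)//= eqxx (bigD1 j) 1?eq_sym//=.
rewrite (negPf ij) eqxx big1 ?mulr1// => k /andP[ki kj].
by rewrite (negPf ki) (negPf kj).
Qed.

Lemma normal_prod_has_int2 (g h : R -> R) (a b : R) i j : i != j ->
  (forall t, 0 <= g t) -> (forall t, 0 <= h t) ->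
  measurable_fun setT g -> measurable_fun setT h ->
  (\int[mu]_t (g t * normal_pdf 0 (s i) t)%:E = a%:E)%E ->
  (\int[mu]_t (h t * normal_pdf 0 (s j) t)%:E = b%:E)%E ->
  Rd_has_int (fun x => q x * (g (x 0 i) * h (x 0 j))) (a * b).
Proof.
move=> ij g0 h0 mg mh ga hb.
have := @normal_prod_has_int
  (fun k t => if k == i then g t else if k == j then h t else 1)
  (fun k => if k == i then a else if k == j then b else 1).
rewrite (@big_if2 (fun=> a) (fun=> b))//.
rewrite (_ : (fun x : 'rV[R]_d => _ * _) = (fun x => q x * (g (x 0 i) * h (x 0 j)))); last first.
  by apply/funext => x; rewrite (@big_if2 (fun k => g (x 0 k)) (fun k => h (x 0 k))).
apply.
- by move=> k t; case: ifP => // _; case: ifP.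
- by move=> k; case: (k == i) => //; case: (k == j).
- move=> k; have [->//|ki] := eqVneq k i; have [->//|kj] := eqVneq k j.
  under eq_integral do rewrite mul1r; exact: integral_normal_pdf.
Qed.

(** Splitting each coordinate into positive and negative parts gives four nonnegative products, all
    with the same integral [a * b]; two of them enter with a plus sign and two with a minus sign. *)
Lemma normal_prod_has_int_mul i j : i != j ->
  Rd_has_int (fun x => q x * (x 0 i * x 0 j)) 0.
Proof.
move=> ij.
have [a [a1 a2]] := normal_half_moment (s_gt0 i).
have [b [b1 b2]] := normal_half_moment (s_gt0 j).
pose gp (t : R) := Num.max t 0; pose gn (t : R) : R := Num.max (- t) 0.
have gp0 t : 0 <= gp t by rewrite le_max lexx orbT.
have gn0 t : 0 <= gn t by rewrite le_max lexx orbT.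
have mgp : measurable_fun setT gp.
  by apply: measurable_maxr; [exact: measurable_id|exact: measurable_cst].
have mgn : measurable_fun setT gn.
  apply: measurable_maxr; last exact: measurable_cst.
  by apply: continuous_measurable_fun => t; exact: opp_continuous.
have gE t : t = gp t - gn t.
  rewrite /gp /gn; have [t0|t0] := leP 0 t.
    by rewrite max_r ?oppr_le0 ?subr0.
  by rewrite max_l ?sub0r ?opprK// oppr_ge0 ltW.
have Hpp := normal_prod_has_int2 ij gp0 gp0 mgp mgp a1 b1.
have Hnn := normal_prod_has_int2 ij gn0 gn0 mgn mgn a2 b2.
have Hpn := normal_prod_has_int2 ij gp0 gn0 mgp mgn a1 b2.
have Hnp := normal_prod_has_int2 ij gn0 gp0 mgn mgp a2 b1.
have := Rd_has_intD (Rd_has_intD Hpp Hnn) (Rd_has_intN (Rd_has_intD Hpn Hnp)).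
rewrite subrr; congr Rd_has_int; apply/funext => x.
by rewrite [in RHS](gE (x 0 i)) [in RHS](gE (x 0 j)); ring.
Qed.

Lemma normal_prod_quad (P : 'M[R]_d) :
  Rd_has_int (fun x => q x * (x *m P *m x^T) 0 0) (\sum_i P i i * s i ^+ 2).
Proof.
have H : Rd_has_int (fun x => \sum_i \sum_j P j i * (q x * (x 0 j * x 0 i)))
    (\sum_i \sum_j P j i * (if j == i then s i ^+ 2 else 0)).
  apply: Rd_has_int_sum => i; apply: Rd_has_int_sum => j; apply: Rd_has_intZ.
  have [->|ji] := eqVneq j i; first exact: normal_prod_has_int_sqr.
  exact: normal_prod_has_int_mul.
have -> : \sum_i P i i * s i ^+ 2 =
    \sum_i \sum_j P j i * (if j == i then s i ^+ 2 else 0).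
  apply: eq_bigr => i _; rewrite (bigD1 i)//= eqxx big1 ?addr0// => j ji.
  by rewrite (negPf ji) mulr0.
move: H; congr Rd_has_int; apply/funext => x.
rewrite mxE mulr_sumr; apply: eq_bigr => i _; rewrite !mxE mulr_suml mulr_sumr.
by apply: eq_bigr => j _; ring.
Qed.

(** The logarithm of the density ratio is a constant plus half the difference of two quadratic
    forms, so the second moments of [q] determine the integral. The form of [q] itself contributes
    the term [d]. *)
Lemma KL_normal_prod_gauss (S : 'M[R]_d) : 0 < \det S ->
  KL q (gauss_density S) = (2^-1 * (ln (\det S) - \sum_i ln (s i ^+ 2)
    + \sum_i invmx S i i * s i ^+ 2 - d%:R))%:E.
Proof.
move=> S0; apply: Rd_has_intE.
(* The inverse covariance of [q], which puts its exponent in the same shape as that of the Gaussian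
   with covariance [S]. *)
pose D : 'M[R]_d := diag_mx (\row_i (s i ^+ 2)^-1).
have DE (x : 'rV[R]_d) : (x *m D *m x^T) 0 0 = \sum_i (s i ^+ 2)^-1 * x 0 i ^+ 2.
  rewrite mxE; apply: eq_bigr => i _; rewrite mul_mx_diag !mxE; ring.
have qE x : q x = expR (- 2^-1 * (d%:R * ln (2 * pi) + \sum_i ln (s i ^+ 2))
    - 2^-1 * (x *m D *m x^T) 0 0).
  rewrite /normal_prod; under eq_bigr do rewrite normal_pdf0_expR//.
  rewrite -expR_sum sumrB -mulr_sumr big_split /= sumr_const card_ord.
  rewrite DE mulr_sumr [d%:R * _]mulr_natl; congr (expR (_ - _)).
  by apply: eq_bigr => i _; rewrite mulrA.
pose c := 2^-1 * (ln (\det S) - \sum_i ln (s i ^+ 2)).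
have H := Rd_has_intD (Rd_has_intZ c normal_prod_has_int1)
  (Rd_has_intD (Rd_has_intZ 2^-1 (normal_prod_quad (invmx S)))
     (Rd_has_intZ (- 2^-1) (normal_prod_quad D))).
have -> : 2^-1 * (ln (\det S) - \sum_i ln (s i ^+ 2)
    + \sum_i invmx S i i * s i ^+ 2 - d%:R) =
  c * 1 + (2^-1 * (\sum_i invmx S i i * s i ^+ 2) +
     - 2^-1 * \sum_i D i i * s i ^+ 2).
  rewrite /c (_ : \sum_i D i i * s i ^+ 2 = d%:R); first ring.
  rewrite -[in RHS](card_ord d) -sumr_const; apply: eq_bigr => i _.
  by rewrite !mxE eqxx mulr1n mulVf// gt_eqF// exprn_gt0.
move: H; congr Rd_has_int; apply/funext => x.
have -> : ln (q x / gauss_density S x) =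
    c + (2^-1 * (x *m invmx S *m x^T) 0 0 - 2^-1 * (x *m D *m x^T) 0 0).
  by rewrite qE gauss_density_expR// -expRN -expRD expRK /c; ring.
by ring.
Qed.

End GaussianKL.

(** * Spectrum of a symmetric matrix *)

Section Spectral.
Import Num.Def.
Local Open Scope sesquilinear_scope.
Local Open Scope complex_scope.
Context {R : realType} {d : nat}.

Local Notation rc := (@real_complex_def R (Phant R)).

(** The diagonalisation takes place over the complex numbers, where [S] is hermitian with real
    spectrum. The rows of [U] are complex eigenvectors; the eigenvalues return to the real field as
    roots of the characteristic polynomial, which the embedding preserves and reflects. *)
Lemma symmetric_spectral (S : 'M[R]_d) : S^T = S ->
  exists (a : 'rV[R]_d) (U : 'M[R[i]]_d),
    [/\ U *m U^t* = 1%:M,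
        map_mx rc S = U^t* *m diag_mx (map_mx rc a) *m U &
        forall i, eigenvalue S (a 0 i)].
Proof.
move=> symS; pose A := map_mx rc S.
have hA : A \is hermsymmx.
  apply: realsym_hermsym.
    apply/is_hermitianmxP; rewrite expr0 scale1r map_mx_id//.
    by rewrite /A map_trmx symS.
  apply/mxOverP => i j; rewrite mxE.
  by have := complex_real (S i j) 0; rewrite eqxx.
have /orthomx_spectralP := hermitian_normalmx hA.
set U := spectralmx A; set sp := spectral_diag A => AE.
have Uu : U \is unitarymx := spectral_unitarymx A.
have spR := hermitian_spectral_diag_real hA.
pose a : 'rV[R]_d := \row_i complex.Re (sp 0 i).
have spE : sp = map_mx rc a.
  apply/rowP => i; rewrite !mxE; move/mxOverP/(_ 0 i): spR; rewrite -/sp.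
  case: (sp 0 i) => x y; rewrite complex_real => /eqP ->.
  by [].
exists a, U; split.
- exact/unitarymxP.
- by rewrite -spE -invmx_unitary.
- move=> i; rewrite eigenvalue_root_char -(fmorph_root rc) map_char_poly -/A.
  rewrite -eigenvalue_root_char; apply/eigenvalueP; exists (row i U).
    rewrite AE -row_mul !mulmxA mulmxV ?unitarymx_unit// mul1mx.
    rewrite row_mul; apply/rowP => j; rewrite !mxE.
    under eq_bigr => k _ do rewrite !mxE eq_sym.
    rewrite (bigD1 i)//= eqxx mulr1n big1 ?addr0 => [|k ki].
      by rewrite spE mxE.
    by rewrite (negPf ki) mulr0n mul0r.
  apply/negP => /eqP U0; have := mxrank_unitary Uu.
  have /row_freeP[B UB] : row_free U by rewrite row_free_unit unitarymx_unit.
  have := congr1 (row i) UB; rewrite row_mul U0 mul0mx => /rowP/(_ i).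
  by rewrite !mxE eqxx => /eqP; rewrite eq_sym oner_eq0.
Qed.

Lemma sym_pos_def_eigenvalue_gt0 (S : 'M[R]_d) (l : R) :
  sym_pos_def S -> eigenvalue S l -> 0 < l.
Proof.
move=> [_ posS] /eigenvalueP[v vS v0].
have := posS v v0; rewrite vS -scalemxAl mxE => h.
have vv : 0 <= (v *m v^T) 0 0.
  by rewrite mxE; apply: sumr_ge0 => i _; rewrite mxE -expr2 sqr_ge0.
rewrite ltNge; apply/negP => l0; move: h; rewrite ltNge => /negP; apply.
exact: mulr_le0_ge0.
Qed.

(** As the diagonalising matrix is complex, only real quantities that are independent of it are
    exported: determinant, traces and a bound on the quadratic form of the inverse. *)
Lemma sym_pos_def_spectrum (S : 'M[R]_d) : sym_pos_def S ->
  exists a : 'I_d -> R,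
    [/\ forall i, eigenvalue S (a i),
        \det S = \prod_i a i,
        \tr (invmx S) = \sum_i (a i)^-1,
        \tr (invmx S *m invmx S) = \sum_i (a i)^-1 ^+ 2 &
        forall (x : 'rV[R]_d) l, 0 < l -> (forall i, l <= a i) ->
          (x *m invmx S *m x^T) 0 0 <= l^-1 * (x *m x^T) 0 0].
Proof.
move=> spdS; have [symS _] := spdS.
have [a [U [UU AE eva]]] := symmetric_spectral symS.
have apos i : 0 < a 0 i := sym_pos_def_eigenvalue_gt0 spdS (eva i).
have UU' : U^t* *m U = 1%:M by exact: mulmx1C.
pose D := diag_mx (map_mx rc a).
pose b : 'rV[R]_d := \row_i (a 0 i)^-1.
pose D' := diag_mx (map_mx rc b).
have DD' : D *m D' = 1%:M.
  rewrite /D /D' mulmx_diag -diag_const_mx; congr diag_mx; apply/rowP => i.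
  by rewrite !mxE -rmorphM divff ?rmorph1// gt_eqF.
have PE : map_mx rc (invmx S) = U^t* *m D' *m U.
  rewrite map_invmx AE -/D.
  have H : (U^t* *m D *m U) *m (U^t* *m D' *m U) = 1%:M.
    rewrite !mulmxA -(mulmxA (U^t* *m D) U) UU mulmx1.
    by rewrite -(mulmxA (U^t*) D) DD' mulmx1.
  have [unitA _] := mulmx1_unit H.
  by rewrite -[LHS]mulmx1 -H mulKmx.
have trE (T : 'M[R]_d) t : map_mx rc T = U^t* *m diag_mx (map_mx rc t) *m U ->
    \tr T = \sum_i t 0 i.
  move=> TE; apply: (@complexI R); rewrite -[LHS]/(rc _) -[RHS]/(rc _).
  rewrite -trace_map_mx TE mxtrace_mulC mulmxA UU mul1mx mxtrace_diag rmorph_sum.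
  by apply: eq_bigr => i _; rewrite mxE.
exists (fun i => a 0 i); split=> //.
- apply: (@complexI R); rewrite -[LHS]/(rc _) -[RHS]/(rc _).
  rewrite -det_map_mx AE !det_mulmx mulrAC -det_mulmx UU' det1 mul1r.
  by rewrite det_diag rmorph_prod; apply: eq_bigr => i _; rewrite mxE.
- by rewrite (trE _ _ PE); apply: eq_bigr => i _; rewrite mxE.
- rewrite (trE _ (\row_i (a 0 i)^-1 ^+ 2)).
    by apply: eq_bigr => i _; rewrite mxE.
  rewrite map_mxM PE !mulmxA -(mulmxA (U^t* *m D') U) UU mulmx1.
  rewrite -(mulmxA (U^t*) D' D').
  have -> // : D' *m D' = diag_mx (map_mx rc (\row_i (a 0 i)^-1 ^+ 2)).
  rewrite mulmx_diag; congr diag_mx.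
  by apply/rowP => i; rewrite !mxE -rmorphM expr2.
- move=> x l l0 la.
  (* Since [x] is real, both quadratic forms become sums of squared moduli of the coordinates of
     [y], with weights 1 / a_i and 1, and are compared term by term. *)
  pose y := map_mx rc x *m U^t*.
  have yt : y^t* = U *m map_mx rc x^T.
    rewrite /y trmx_mul map_mxM /= trmxCK; congr (_ *m _).
    by apply/matrixP => i j; rewrite !mxE; exact: conjc_real.
  have E1 : rc ((x *m invmx S *m x^T) 0 0) = \sum_i rc (b 0 i) * (y 0 i * (y 0 i)^*).
    rewrite -[LHS](@mxE _ _ _ map_mx_key (fun i j => rc ((x *m invmx S *m x^T) i j))).
    rewrite -/(map_mx rc _) !map_mxM PE !mulmxA -/y -mulmxA -yt.
    rewrite mxE; apply: eq_bigr => i _; rewrite mul_mx_diag !mxE.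
    by rewrite mulrA [rc _ * _]mulrC.
  have E2 : rc ((x *m x^T) 0 0) = \sum_i (y 0 i * (y 0 i)^*).
    rewrite -[LHS](@mxE _ _ _ map_mx_key (fun i j => rc ((x *m x^T) i j))).
    rewrite -/(map_mx rc _) !map_mxM -[map_mx rc x]mulmx1 -UU' mulmxA -/y.
    rewrite -mulmxA -yt.
    by rewrite mxE; apply: eq_bigr => i _; rewrite !mxE.
  rewrite -lecR -[leLHS]/(rc _) -[leRHS]/(rc _) rmorphM /= E1 E2 mulr_sumr.
  apply: ler_sum => i _; rewrite ler_wpM2r ?mul_conjC_ge0//.
  by rewrite lecR mxE lef_pV2 ?posrE.
Qed.

End Spectral.

(** * Haar measure on the orthogonal group *)

Section BilinearForm.
Context {R : realType} {d : nat}.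
Implicit Types (A Q : 'M[R]_d) (u v : 'rV[R]_d).

Definition bil A u v : R := (u *m A *m v^T) 0 0.

Lemma bilDl A u u' v : bil A (u + u') v = bil A u v + bil A u' v.
Proof. by rewrite /bil !mulmxDl mxE. Qed.

Lemma bilDr A u v v' : bil A u (v + v') = bil A u v + bil A u v'.
Proof. by rewrite /bil linearD mulmxDr mxE. Qed.

Lemma bilZl A c u v : bil A (c *: u) v = c * bil A u v.
Proof. by rewrite /bil -!scalemxAl mxE. Qed.

Lemma bilZr A c u v : bil A u (c *: v) = c * bil A u v.
Proof. by rewrite /bil linearZ -scalemxAr mxE. Qed.

Lemma bil_delta A k l : bil A (delta_mx 0 k) (delta_mx 0 l) = A k l.
Proof. by rewrite /bil -rowE trmx_delta -colE !mxE. Qed.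

Lemma conj_mxE A Q k l : (Q *m A *m Q^T) k l = bil A (row k Q) (row l Q).
Proof.
by rewrite /bil -row_mul tr_row mxE [RHS]mxE; apply: eq_bigr => i _; rewrite !mxE.
Qed.

(** Given by rows, because the entries of a conjugate [Q *m A *m Q^T] are the values of [bil A] on
    the rows of [Q]. *)
Definition rot45 (i j : 'I_d) : 'M[R]_d :=
  \matrix_k (if k == i then (Num.sqrt 2)^-1 *: (delta_mx 0 i + delta_mx 0 j)
             else if k == j then
               (Num.sqrt 2)^-1 *: (delta_mx 0 j + (-1) *: delta_mx 0 i)
             else delta_mx 0 k).

Let isqrt2 : (Num.sqrt 2)^-1 * (Num.sqrt 2)^-1 = 2^-1 :> R.
Proof. by rewrite -invfM -expr2 sqr_sqrtr. Qed.

Lemma rot45_orthogonal i j : i != j -> orthogonal_mx (rot45 i j).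
Proof.
move=> ij; have ji : j != i by rewrite eq_sym.
apply/matrixP => k l; rewrite -[X in X *m _]mulmx1 conj_mxE !rowK.
have [->|ki] := eqVneq k i; have [->|li] := eqVneq l i;
  try (have [->|kj] := eqVneq k j); try (have [->|lj] := eqVneq l j);
  rewrite ?(bilZl, bilZr, bilDl, bilDr, bil_delta) !mxE ?eqxx;
  rewrite ?(negPf ij) ?(negPf ji) ?(negPf ki) ?(negPf kj) ?(negPf li) ?(negPf lj);
  rewrite ?[i == l]eq_sym ?[j == l]eq_sym ?(negPf li) ?(negPf lj);
  rewrite ?mulr1n ?mulr0n ?mulr0 ?addr0 ?add0r ?mulr1 ?isqrt2 //;
  rewrite ?mulrA ?isqrt2; lra.
Qed.

(** With m = (A_ii + A_jj) / 2, the two rotated diagonal entries are m + A_ij and m - A_ij; the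
    cross terms cancel when their squares are added. *)
Lemma rot45_conj A i j : i != j -> A^T = A ->
  (rot45 i j *m A *m (rot45 i j)^T) i i ^+ 2 +
  (rot45 i j *m A *m (rot45 i j)^T) j j ^+ 2 =
  2^-1 * (A i i + A j j) ^+ 2 + 2 * A i j ^+ 2.
Proof.
move=> ij symA; rewrite !conj_mxE !rowK !eqxx eq_sym (negPf ij).
rewrite !(bilZl, bilZr, bilDl, bilDr, bil_delta).
have -> : A j i = A i j by rewrite -[in RHS]symA mxE.
by rewrite !(mulrA (Num.sqrt 2)^-1 (Num.sqrt 2)^-1) isqrt2; field.
Qed.

End BilinearForm.

Section Haar.
Context {R : realType} {d : nat}.
Local Notation O := [set M : MxSpace R d | orthogonal_mx M].

Lemma measurable_mx_entry (i j : 'I_d) :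
  measurable_fun setT (fun M : MxSpace R d => (M : 'M[R]_d) i j).
Proof.
move=> _ B mB; rewrite setTI; apply: sub_gen_smallest.
by exists i, j, B.
Qed.

Definition mx_measurable (disp : measure_display) (X : measurableType disp)
    (m n : nat) (F : X -> 'M[R]_(m, n)) : Prop :=
  forall i j, measurable_fun setT (fun x => F x i j).

Lemma mx_measurable_mul (disp : measure_display) (X : measurableType disp)
    (m n p : nat) (F : X -> 'M[R]_(m, n)) (G : X -> 'M[R]_(n, p)) :
  mx_measurable F -> mx_measurable G -> mx_measurable (fun x => F x *m G x).
Proof.
move=> mF mG i j.
rewrite (_ : (fun x => _) = (fun x => \sum_k F x i k * G x k j)); last first.
  by apply/funext => x; rewrite mxE.
by apply: measurable_sum => k; apply: measurable_funM; [exact: mF|exact: mG].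
Qed.

Lemma mx_measurable_tr (disp : measure_display) (X : measurableType disp)
    (m n : nat) (F : X -> 'M[R]_(m, n)) :
  mx_measurable F -> mx_measurable (fun x => (F x)^T).
Proof.
move=> mF i j.
rewrite (_ : (fun x => _) = (fun x => F x j i)); first exact: mF.
by apply/funext => x; rewrite mxE.
Qed.

Lemma mx_measurable_cst (disp : measure_display) (X : measurableType disp)
    (m n : nat) (A : 'M[R]_(m, n)) : mx_measurable (fun _ : X => A).
Proof. by move=> i j; exact: measurable_cst. Qed.

Lemma mx_measurable_id : mx_measurable (fun M : MxSpace R d => (M : 'M[R]_d)).
Proof. exact: measurable_mx_entry. Qed.

Lemma mx_measurable_conj (P : 'M[R]_d) :
  mx_measurable (fun M : MxSpace R d => (M : 'M[R]_d) *m P *m (M : 'M[R]_d)^T).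
Proof.
apply: mx_measurable_mul; last by apply: mx_measurable_tr; exact: mx_measurable_id.
by apply: mx_measurable_mul; [exact: mx_measurable_id|exact: mx_measurable_cst].
Qed.

Lemma mx_measurableP (disp : measure_display) (X : measurableType disp)
    (F : X -> MxSpace R d) :
  mx_measurable (F : X -> 'M[R]_d) -> measurable_fun setT F.
Proof.
move=> mF; apply: (@measurability _ _ X (MxSpace R d) setT F
  (@mx_entry_sets R d)) => //.
move=> _ [_ [i [j [B [mB ->]]]] <-].
by have := mF i j measurableT B mB.
Qed.

Lemma measurable_orthogonal : measurable O.
Proof.
pose F (p : 'I_d * 'I_d) := (fun M : MxSpace R d =>
  ((M : 'M[R]_d) *m 1%:M *m (M : 'M[R]_d)^T) p.1 p.2) @^-1` [set (1%:M : 'M[R]_d) p.1 p.2].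
have -> : O = \bigcap_(p in [set: 'I_d * 'I_d]) F p.
  apply/seteqP; split=> M /=.
    by move=> OM p _; rewrite /F /= mulmx1 OM.
  move=> FM; apply/matrixP => i j; have := FM (i, j) I.
  by rewrite /F /= mulmx1.
apply: fin_bigcap_measurable; first exact: finite_finset.
move=> p _; rewrite -[F p]setTI.
exact: (mx_measurable_conj 1%:M p.1 p.2).
Qed.

Context (mu : probability (MxSpace R d) R).
Context (haar : haar_orthogonal mu).

(** Change of variables along left multiplication by [Q]: the set of orthogonal matrices is its own
    preimage, and invariance says that the pushforward of [mu] agrees with [mu] on measurable
    sets. *)
Lemma haar_integral_mul (Q : 'M[R]_d) (h : MxSpace R d -> \bar R) :
  orthogonal_mx Q -> measurable_fun setT h -> (forall M, 0 <= h M)%E ->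
  (\int[mu]_(M in O) h (Q *m (M : 'M[R]_d)) = \int[mu]_(M in O) h M)%E.
Proof.
move=> oQ mh h0.
pose phi (M : MxSpace R d) : MxSpace R d := Q *m (M : 'M[R]_d).
have mphi : measurable_fun setT phi.
  apply: mx_measurableP; apply: mx_measurable_mul; last exact: mx_measurable_id.
  exact: mx_measurable_cst.
have pO : phi @^-1` O = O.
  apply/seteqP; split=> M; rewrite /phi /= /orthogonal_mx trmx_mul => H.
    have QtQ := mulmx1C oQ.
    have : Q^T *m (Q *m M *m (M^T *m Q^T)) *m Q = 1%:M by rewrite H mulmx1.
    by rewrite !mulmxA QtQ mul1mx -!mulmxA QtQ mulmx1.
  by rewrite mulmxA -(mulmxA Q) H mulmx1.
have := @ge0_integral_pushforward _ _ _ _ _ phi mphi mu O h measurable_orthogonal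
  (measurable_funTS mh) (fun M _ => h0 M).
rewrite pO => <-.
pose m1 : {measure set (MxSpace R d) -> \bar R} :=
  measure_function_pushforward__canonical__measure_function_Measure mu mphi.
apply: (@eq_measure_integral _ _ _ O mu m1) => A mA _.
exact: (haar.2 Q oQ A mA).
Qed.

End Haar.

(** * Second moment of the diagonal of a Haar-random conjugate *)

Section HaarMoment.
Context {R : realType} {d : nat} (mu : probability (MxSpace R d) R).
Context (haar : haar_orthogonal mu) (P : 'M[R]_d) (symP : P^T = P).
Local Notation O := [set M : MxSpace R d | orthogonal_mx M].

Definition conj_mx (M : MxSpace R d) : 'M[R]_d := (M : 'M[R]_d) *m P *m (M : 'M[R]_d)^T.
Local Notation A := conj_mx.

Definition diag_sqr (M : MxSpace R d) : R := \sum_i A M i i ^+ 2.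

Lemma conj_mx_sym M : (A M)^T = A M.
Proof. by rewrite /conj_mx !trmx_mul trmxK symP mulmxA. Qed.

Lemma conj_mx_trace M : O M -> \tr (A M) = \tr P.
Proof. by move=> /mulmx1C OM; rewrite /conj_mx mxtrace_mulC mulmxA OM mul1mx. Qed.

(** The sum is the squared Frobenius norm, which orthogonal conjugation preserves. *)
Lemma conj_mx_sum_sqr M : O M -> \sum_i \sum_j A M i j ^+ 2 = \tr (P *m P).
Proof.
move=> /mulmx1C OM.
transitivity (\tr (A M *m (A M)^T)).
  apply: eq_bigr => i _; rewrite mxE; apply: eq_bigr => j _.
  by rewrite [(A M)^T j i]mxE expr2.
rewrite conj_mx_sym /conj_mx !mulmxA -(mulmxA (M *m P)) OM mulmx1.
by rewrite mxtrace_mulC !mulmxA OM mul1mx.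
Qed.

Lemma measurable_conj_mx i j : measurable_fun setT (fun M => A M i j).
Proof. exact: mx_measurable_conj. Qed.

Lemma measurable_diag_sqr : measurable_fun setT diag_sqr.
Proof.
apply: measurable_sum => i; apply: measurable_funX; exact: measurable_conj_mx.
Qed.

Lemma diag_sqr_ge0 M : 0 <= diag_sqr M.
Proof. by apply: sumr_ge0 => i _; exact: sqr_ge0. Qed.

Lemma diag_sqr_le M : O M -> diag_sqr M <= \tr (P *m P).
Proof.
move=> OM; rewrite -(conj_mx_sum_sqr OM); apply: ler_sum => i _.
by rewrite (bigD1 i)//= lerDl; apply: sumr_ge0 => j _; exact: sqr_ge0.
Qed.

(** [f] and [g] are the two sides of [rot45_conj], set to 0 on the diagonal so that their sums can
    run over all ordered pairs. *)
Let f (p : 'I_d * 'I_d) M := if p.1 != p.2 then A M p.1 p.1 ^+ 2 + A M p.2 p.2 ^+ 2 else 0.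
Let g (p : 'I_d * 'I_d) M := if p.1 != p.2 then
  2^-1 * (A M p.1 p.1 + A M p.2 p.2) ^+ 2 + 2 * A M p.1 p.2 ^+ 2 else 0.

Let f_ge0 p M : 0 <= f p M.
Proof. by rewrite /f; case: ifP => // _; rewrite addr_ge0 ?sqr_ge0. Qed.

Let g_ge0 p M : 0 <= g p M.
Proof.
rewrite /g; case: ifP => // _.
by apply: addr_ge0; apply: mulr_ge0; rewrite ?invr_ge0 ?sqr_ge0.
Qed.

Let mf p : measurable_fun setT (f p).
Proof.
rewrite /f; case: (p.1 != p.2); last exact: measurable_cst.
by apply: measurable_funD; apply: measurable_funX; exact: measurable_conj_mx.
Qed.

Let mg p : measurable_fun setT (g p).
Proof.
rewrite /g; case: (p.1 != p.2); last exact: measurable_cst.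
apply: measurable_funD; apply: measurable_funM;
  try exact: measurable_cst; apply: measurable_funX; last exact: measurable_conj_mx.
by apply: measurable_funD; exact: measurable_conj_mx.
Qed.

(** Left multiplication of [M] by the rotation conjugates [A M] by it, which turns [f] into [g];
    Haar invariance does the rest. *)
Let int_fg p : (\int[mu]_(M in O) (f p M)%:E = \int[mu]_(M in O) (g p M)%:E)%E.
Proof.
case: p => i j; have [ij|ij] := boolP (i != j); last first.
  by apply: eq_integral => M _; rewrite /f /g /= (negPf ij).
rewrite -(haar_integral_mul haar (rot45_orthogonal ij)).
- apply: eq_integral => M _; rewrite /f /g /= ij -rot45_conj ?conj_mx_sym//.
  by rewrite /conj_mx trmx_mul !mulmxA.
- by apply/measurable_EFinP; exact: mf.
- by move=> M; rewrite lee_fin.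
Qed.

(** Each A_ii^2 occurs in 2 (d - 1) ordered pairs of distinct indices. *)
Let sum_f M : \sum_p f p M = (2 * (d%:R - 1)) * diag_sqr M.
Proof.
transitivity (\sum_i \sum_j (A M i i ^+ 2 + A M j j ^+ 2) -
   \sum_i \sum_j (if i == j then A M i i ^+ 2 + A M j j ^+ 2 else 0)).
  rewrite -sumrB -(pair_bigA _ (fun i j => f (i, j) M)) /=.
  apply: eq_bigr => i _; rewrite -sumrB; apply: eq_bigr => j _.
  by rewrite /f /=; case: eqVneq => _; rewrite ?subrr ?subr0.
have -> : \sum_i \sum_j (if i == j then A M i i ^+ 2 + A M j j ^+ 2 else 0) =
    2 * diag_sqr M.
  rewrite mulr_sumr; apply: eq_bigr => i _.
  rewrite (bigD1 i)//= eqxx big1 ?addr0 => [|j ji]; first by ring.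
  by rewrite eq_sym (negPf ji).
have -> : \sum_i \sum_j (A M i i ^+ 2 + A M j j ^+ 2) = 2 * d%:R * diag_sqr M.
  have cstE (c : R) : \sum_(j < d) c = d%:R * c.
    by rewrite sumr_const card_ord mulr_natl.
  under eq_bigr do rewrite big_split /= cstE.
  by rewrite big_split /= cstE -mulr_sumr -/(diag_sqr M); ring.
by ring.
Qed.

(** Expanding the square in [g] yields half of [f], the products A_ii A_jj and 2 A_ij^2. Completing
    the last two sums to all pairs costs one and two copies of [diag_sqr], whence the 3; the
    completed sums are (tr P)^2 and 2 tr P^2. *)
Let sum_g M : O M -> \sum_p g p M + 3 * diag_sqr M =
  (d%:R - 1) * diag_sqr M + ((\tr P) ^+ 2 + 2 * \tr (P *m P)).
Proof.
move=> OM; rewrite -(conj_mx_sum_sqr OM) -(conj_mx_trace OM).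
have -> : \sum_p g p M = 2^-1 * \sum_p f p M +
    (\sum_i \sum_j A M i i * A M j j - diag_sqr M) +
    2 * (\sum_i \sum_j A M i j ^+ 2 - diag_sqr M).
  rewrite -!(pair_bigA _ (fun i j => g (i, j) M)) -(pair_bigA _ (fun i j => f (i, j) M)) /=.
  rewrite -!sumrB !mulr_sumr -!big_split /=; apply: eq_bigr => i _.
  have dE (h : 'I_d -> R) : h i = \sum_j (if i == j then h i else 0).
    rewrite (bigD1 i)//= eqxx big1 ?addr0// => j ji.
    by rewrite eq_sym (negPf ji).
  rewrite (dE (fun i => A M i i ^+ 2)) -!sumrB !mulr_sumr -!big_split /=.
  apply: eq_bigr => j _; rewrite /f /g /=.
  by have [->|ij] := eqVneq i j => /=; field.
rewrite sum_f.
have -> : \sum_i \sum_j A M i i * A M j j = \tr (A M) ^+ 2.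
  by rewrite expr2 /mxtrace mulr_suml; apply: eq_bigr => i _; rewrite mulr_sumr.
by field.
Qed.

Lemma integrable_diag_sqr : mu.-integrable O (fun M => (diag_sqr M)%:E).
Proof.
have mO := @measurable_orthogonal R d.
have D0 M : (0 <= (diag_sqr M)%:E)%E by rewrite lee_fin diag_sqr_ge0.
have trPP0 : 0 <= \tr (P *m P).
  rewrite -[in X in _ *m X]symP; apply: sumr_ge0 => i _; rewrite mxE.
  by apply: sumr_ge0 => j _; rewrite mxE -expr2 sqr_ge0.
have mD : measurable_fun O (fun M => (diag_sqr M)%:E).
  by apply/measurable_EFinP; apply: measurable_funTS; exact: measurable_diag_sqr.
apply/integrableP; split=> //.
under eq_integral do rewrite gee0_abs//.
apply: (@le_lt_trans _ _ (\tr (P *m P))%:E); last exact: ltry.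
rewrite -[leRHS]mule1 -haar.1 -integral_cst//; apply: ge0_le_integral => //.
by move=> M OM; rewrite lee_fin diag_sqr_le.
Qed.

(** Integrating [sum_f] and [sum_g] gives 2 (d - 1) e = (d - 4) e + C for the expectation [e]. It is
    finite because [diag_sqr] is bounded on orthogonal matrices, so the equation can be solved. *)
Lemma haar_diag_sqr : (\int[mu]_(M in O) (diag_sqr M)%:E =
  (((\tr P) ^+ 2 + 2 * \tr (P *m P)) / (d%:R + 2))%:E)%E.
Proof.
have mO := @measurable_orthogonal R d.
have muO : mu O = 1%E := haar.1.
have iD := integrable_diag_sqr.
set e := (X in X = _).
have efin : e \is a fin_num := integrable_fin_num mO iD.
have If : (\int[mu]_(M in O) (\sum_p f p M)%:E = \int[mu]_(M in O) (\sum_p g p M)%:E)%E.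
  under eq_integral do rewrite -sumEFin.
  rewrite ge0_integral_sum//; first last.
  - by move=> p M _; rewrite lee_fin.
  - by move=> p; apply/measurable_EFinP; apply: measurable_funTS; exact: mf.
  under [RHS]eq_integral do rewrite -sumEFin.
  rewrite ge0_integral_sum//; first last.
  - by move=> p M _; rewrite lee_fin.
  - by move=> p; apply/measurable_EFinP; apply: measurable_funTS; exact: mg.
  by apply: eq_bigr => p _; exact: int_fg.
set C := (\tr P) ^+ 2 + 2 * \tr (P *m P).
have If1 : (\int[mu]_(M in O) (\sum_p f p M)%:E = (2 * (d%:R - 1))%:E * e)%E.
  under eq_integral do rewrite sum_f EFinM.
  by rewrite integralZl.
have Ig1 : (\int[mu]_(M in O) (\sum_p g p M)%:E = (d%:R - 4)%:E * e + C%:E)%E.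
  transitivity (\int[mu]_(M in O) ((d%:R - 4)%:E * (diag_sqr M)%:E + cst C%:E M))%E.
    apply: eq_integral => M; rewrite inE => OM; rewrite -EFinM -EFinD; congr EFin.
    by have := sum_g OM; rewrite -/C; lra.
  rewrite integralD//; last exact: finite_measure_integrable_cst; last exact: integrableZl.
  congr (_ + _)%E; first by rewrite integralZl.
  by rewrite -[RHS]mule1 -muO; exact: integral_cst.
move: If; rewrite If1 Ig1 -(fineK efin).
rewrite -!EFinM -EFinD => -[] H; congr EFin.
have d2 : d%:R + 2 != 0 :> R by rewrite gt_eqF// ltr_wpDl.
by apply: (mulIf d2); rewrite divfK//; lra.
Qed.

End HaarMoment.

(** * Logarithm bounds and integrals of non-measurable functions *)

Section LogBounds.
Context {R : realType}.
Implicit Types (f w : R -> R) (x y m M : R).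

(** By the mean value theorem between 1 and [y], [f y] is (c - 1) (y - 1) w(c) for an intermediate
    point c, and the first two factors have the same sign. *)
Lemma ge0_of_derive_sign f w y : 0 < y -> f 1 = 0 ->
  (forall x, 0 < x -> is_derive x 1 f ((x - 1) * w x)) ->
  (forall x, 0 < x -> x <= Num.max 1 y -> Num.min 1 y <= x -> 0 <= w x) -> 0 <= f y.
Proof.
move=> y0 f1 df w0.
have cont a b : 0 < a -> {within `[a, b], continuous f}.
  move=> a0; apply: derivable_within_continuous => x.
  rewrite in_itv /= => /andP[ax _].
  by have [] := df x (lt_le_trans a0 ax).
have [y1|y1|->] := ltgtP y 1; last by rewrite f1.
- have [|c] := @MVT R f (fun x => (x - 1) * w x) y 1 y1 _ (cont _ _ y0).
    move=> x; rewrite in_itv /= => /andP[yx _].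
    exact/df/(lt_trans y0 yx).
  rewrite in_itv /= f1 sub0r => /andP[yc c1] /eqP; rewrite eqr_oppLR => /eqP ->.
  have wc : 0 <= w c.
    by apply: w0; rewrite ?(lt_trans y0 yc)// ?le_max ?ge_min ?(ltW c1) ?(ltW yc) ?orbT.
  rewrite -mulNr mulr_ge0 ?subr_ge0 ?(ltW y1)// -mulNr mulr_ge0// opprB subr_ge0.
  exact: ltW.
- have [|c] := @MVT R f (fun x => (x - 1) * w x) 1 y y1 _ (cont _ _ ltr01).
    move=> x; rewrite in_itv /= => /andP[yx _].
    exact/df/(lt_trans ltr01 yx).
  rewrite in_itv /= f1 subr0 => /andP[yc c1] ->.
  have wc : 0 <= w c.
    by apply: w0; rewrite ?(lt_trans ltr01 yc)// ?le_max ?ge_min ?(ltW c1) ?(ltW yc) ?orbT.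
  rewrite mulr_ge0 ?subr_ge0 ?(ltW y1)// mulr_ge0// subr_ge0; exact: ltW.
Qed.

(** Taylor bound at 1, as 1 / M^2 is the least second derivative of - ln on ]0, M]. The difference
    has derivative (x - 1) (1 / x - 1 / M^2), whose second factor is nonnegative up to M^2 >= M. *)
Lemma ln_le_quad x M : 1 <= M -> 0 < x -> x <= M ->
  ln x <= x - 1 - (x - 1) ^+ 2 / (2 * M ^+ 2).
Proof.
move=> M1 x0 xM; have M0 : 0 < M := lt_le_trans ltr01 M1.
rewrite -subr_ge0.
pose f (x : R) : R := x - 1 - (x - 1) ^+ 2 / (2 * M ^+ 2) - ln x.
apply: (@ge0_of_derive_sign f (fun x => x^-1 - (M ^+ 2)^-1) x x0); rewrite {}/f.
- by rewrite ln1 subrr expr0n /= mul0r !subr0.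
- move=> y y0; have := is_derive1_ln y0 => dln.
  apply: is_derive_eq; rewrite /GRing.scale /=.
  by field; rewrite !gt_eqF.
- move=> y y0 yle _; rewrite subr_ge0 lef_pV2 ?posrE ?exprn_gt0//.
  apply: le_trans yle _; rewrite ge_max; apply/andP; split; first exact: exprn_ege1.
  by apply: le_trans xM _; rewrite expr2 ler_peMr// ltW.
Qed.

(** Mirror image of [ln_le_quad]: 1 / m^2 is the largest second derivative of - ln on [m, +oo[, and
    points above m lie above m^2. *)
Lemma ln_ge_quad x m : 0 < m -> m <= 1 -> m <= x ->
  x - 1 - (x - 1) ^+ 2 / (2 * m ^+ 2) <= ln x.
Proof.
move=> m0 m1 mx; have x0 : 0 < x := lt_le_trans m0 mx.
rewrite -subr_ge0.
pose f (x : R) : R := ln x - (x - 1 - (x - 1) ^+ 2 / (2 * m ^+ 2)).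
apply: (@ge0_of_derive_sign f (fun x => (m ^+ 2)^-1 - x^-1) x x0); rewrite {}/f.
- by rewrite ln1 subrr expr0n /= mul0r !subr0.
- move=> y y0; have := is_derive1_ln y0 => dln.
  apply: is_derive_eq; rewrite /GRing.scale /=.
  by field; rewrite !gt_eqF.
- move=> y y0 _ yge; rewrite subr_ge0 lef_pV2 ?posrE ?exprn_gt0//.
  apply: le_trans yge; rewrite le_min; apply/andP; split.
    by apply: exprn_ile1 => //; exact: ltW.
  by apply: le_trans mx; rewrite expr2 ler_piMr// ltW.
Qed.

End LogBounds.

Section NonmeasurableIntegral.
Context (disp : measure_display) (T : measurableType disp) (R : realType).
Context (mu : {measure set T -> \bar R}).
Implicit Types f g : T -> \bar R.

(* Integrals are defined as suprema over simple functions, so monotonicity needs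
   no measurability; the infimum over product densities is not known to be
   measurable in the rotation. *)
Lemma le_integral_nonmeasurable f g :
  (forall x, f x <= g x)%E -> (\int[mu]_x f x <= \int[mu]_x g x)%E.
Proof.
move=> fg; rewrite /integral !patch_setT; apply: leeB.
  apply: ereal_sup_le => _ [h hf <-]; exists h => // x.
  by apply: le_trans (hf x) _; apply: (@funepos_le _ _ setT) => //; rewrite inE.
apply: ereal_sup_le => _ [h hf <-]; exists h => // x.
by apply: le_trans (hf x) _; apply: (@funeneg_le _ _ setT) => //; rewrite inE.
Qed.

Lemma le_integral_ae_nonmeasurable (D : set T) f g :
  measurable D -> mu (~` D) = 0%E -> measurable_fun setT g ->
  (forall x, D x -> f x <= g x)%E -> (\int[mu]_x f x <= \int[mu]_x g x)%E.
Proof.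
move=> mD D0 mg fg.
(* Raising [g] to [+oo] on the null complement makes the domination hold everywhere and leaves its
   integral unchanged. *)
pose g' x := (if x \in D then g x else +oo)%E.
have mg' : measurable_fun setT g'.
  apply: measurable_fun_ifT => //.
  apply: (measurable_fun_bool true); rewrite setTI.
  by rewrite (_ : _ @^-1` _ = D)//; apply/seteqP; split=> x /= h; [exact: set_mem|exact: mem_set].
rewrite (@ae_eq_integral _ _ _ _ setT g' g)//.
  apply: le_integral_nonmeasurable => x; rewrite /g'; case: ifPn => [|_].
    by rewrite inE; exact: fg.
  exact: leey.
exists (~` D); split=> //; first exact: measurableC.
by move=> x /= H Dx; apply: H => _; rewrite /g' mem_set.
Qed.

End NonmeasurableIntegral.

(** * The mean-field bound *)

Section MeanField.
Context {R : realType} {d : nat}.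
Implicit Types (S : 'M[R]_d).

(** Lets the same closed formula for the divergence serve on both sides of the final inequality. *)
Lemma gauss_density1 : gauss_density (1%:M : 'M[R]_d) = normal_prod (fun=> 1).
Proof.
apply/funext => x; rewrite gauss_density_expR ?det1 ?ltr01//.
rewrite /normal_prod; under eq_bigr do rewrite normal_pdf0_expR//.
rewrite -expR_sum; congr expR.
rewrite sumrB sumr_const card_ord expr1n ln1 !addr0 -[X in _ = X - _]mulr_natl.
congr (_ - _); first by ring.
rewrite invmx1 mulmx1 mxE mulr_sumr; apply: eq_bigr => i _.
by rewrite invr1 mulr1 mxE expr2.
Qed.

Lemma sym_pos_def_det_gt0 S : sym_pos_def S -> 0 < \det S.
Proof.
move=> spdS; have [a [eva -> _ _ _]] := sym_pos_def_spectrum spdS.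
by apply: prodr_gt0 => i _; exact: sym_pos_def_eigenvalue_gt0 (eva i).
Qed.

Lemma sym_pos_def_unitmx S : sym_pos_def S -> S \in unitmx.
Proof. by move=> /sym_pos_def_det_gt0 S0; rewrite unitmxE unitfE gt_eqF. Qed.

Lemma sym_pos_def_invmx_sym S : sym_pos_def S -> (invmx S)^T = invmx S.
Proof. by move=> [symS _]; rewrite trmx_inv symS. Qed.

Lemma sym_pos_def_invmx_gt0 S (x : 'rV[R]_d) : sym_pos_def S -> x != 0 ->
  0 < (x *m invmx S *m x^T) 0 0.
Proof.
move=> spdS x0; have uS := sym_pos_def_unitmx spdS.
have y0 : x *m invmx S != 0.
  by apply: contraNneq x0 => y0; rewrite -(mulmxKV uS x) y0 mul0mx.
have := spdS.2 _ y0.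
by rewrite trmx_mul sym_pos_def_invmx_sym// mulmxKV// mulmxA.
Qed.

Lemma orthogonal_invmx (Q S : 'M[R]_d) : orthogonal_mx Q -> S \in unitmx ->
  invmx (Q *m S *m Q^T) = Q *m invmx S *m Q^T.
Proof.
move=> oQ uS; have QtQ := mulmx1C oQ.
have H : (Q *m S *m Q^T) *m (Q *m invmx S *m Q^T) = 1%:M.
  rewrite !mulmxA -(mulmxA (Q *m S)) QtQ mulmx1 -(mulmxA Q) mulmxV// mulmx1.
  exact: oQ.
have [u _] := mulmx1_unit H.
by rewrite -[LHS]mulmx1 -H mulKmx.
Qed.

Lemma orthogonal_det (Q S : 'M[R]_d) : orthogonal_mx Q ->
  \det (Q *m S *m Q^T) = \det S.
Proof.
by move=> oQ; rewrite !det_mulmx mulrAC -det_mulmx oQ det1 mul1r.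
Qed.

Lemma orthogonal_conj_invmx_gt0 S (Q : 'M[R]_d) i :
  sym_pos_def S -> orthogonal_mx Q -> 0 < (Q *m invmx S *m Q^T) i i.
Proof.
move=> spdS oQ; rewrite conj_mxE; apply: sym_pos_def_invmx_gt0 => //.
apply/negP => /eqP Qi; have /rowP/(_ i) := congr1 (row i) oQ.
by rewrite row_mul Qi mul0mx !mxE eqxx => /eqP; rewrite eq_sym oner_eq0.
Qed.

(** The variance 1 / A_ii minimises v |-> A_ii v - ln v, the contribution of coordinate i to twice
    the divergence; at this choice the trace term equals d and cancels. *)
Lemma inf_KL_rotated_gauss S (Q : 'M[R]_d) :
  sym_pos_def S -> orthogonal_mx Q ->
  (ereal_inf [set KL q (gauss_density (Q *m S *m Q^T)) | q in @Pprod R d] <=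
   (2^-1 * (ln (\det S) + \sum_i ln ((Q *m invmx S *m Q^T) i i)))%:E)%E.
Proof.
move=> spdS oQ; set A := Q *m invmx S *m Q^T.
have A0 i : 0 < A i i := orthogonal_conj_invmx_gt0 i spdS oQ.
pose s i := (Num.sqrt (A i i))^-1.
have s0 i : 0 < s i by rewrite invr_gt0 sqrtr_gt0.
have sE i : s i ^+ 2 = (A i i)^-1 by rewrite exprVn sqr_sqrtr// ltW.
apply: ereal_inf_lbound; exists (normal_prod s).
  exists (fun i => normal_pdf 0 (s i)); split; first by move=> i x; exact: normal_pdf0_gt0.
  split; first by move=> i; exact: C1_normal_pdf0.
  by split=> // i; exact: integral_normal_pdf.
have detE := orthogonal_det S oQ.
rewrite KL_normal_prod_gauss ?detE ?sym_pos_def_det_gt0//.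
rewrite orthogonal_invmx ?sym_pos_def_unitmx// -/A.
have -> : \sum_i A i i * s i ^+ 2 = d%:R.
  rewrite -[in RHS](card_ord d) -sumr_const; apply: eq_bigr => i _.
  by rewrite sE divff// gt_eqF.
have -> : \sum_i ln (s i ^+ 2) = - \sum_i ln (A i i).
  by rewrite -sumrN; apply: eq_bigr => i _; rewrite sE lnV// posrE.
by congr EFin; ring.
Qed.

End MeanField.

Theorem theorem4 (R : realType) (d : nat) (S : 'M[R]_d)
  (lmax lmin : R) (mu : probability (MxSpace R d) R) :
  sym_pos_def S ->
  (forall i : 'I_d, invmx S i i = 1) ->
  (* lmax, lmin are the largest and smallest eigenvalues of S *)
  eigenvalue S lmax -> (forall a, eigenvalue S a -> a <= lmax) ->
  eigenvalue S lmin -> (forall a, eigenvalue S a -> lmin <= a) ->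
  (* mu is the Haar (uniform) probability measure on O(d) *)
  haar_orthogonal mu ->
  let kappa := lmax / lmin in
  (\int[mu]_(Q in setT)
     ereal_inf [set KL q (gauss_density (Q *m S *m Q^T)) | q in @Pprod R d]
   <= (1 - 2 / ((d%:R + 2) * kappa ^+ 2))%:E
      * KL (gauss_density (1%:M : 'M[R]_d)) (gauss_density S))%E.
Proof.
move=> spdS P1 emax lemax emin lemin haar; cbv zeta.
have [a [eva detS trP trPP bnd]] := sym_pos_def_spectrum spdS.
set P := invmx S in P1 trP trPP bnd.
have symP : P^T = P := sym_pos_def_invmx_sym spdS.
have lmin0 := sym_pos_def_eigenvalue_gt0 spdS emin.
have lmax0 := sym_pos_def_eigenvalue_gt0 spdS emax.
have a0 i : 0 < a i := sym_pos_def_eigenvalue_gt0 spdS (eva i).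
(* In dimension 0 every row vector is 0, so no eigenvalue could exist. *)
have d0 : (0 < d)%N.
  case: (posnP d) emax => // d0 /eigenvalueP[v _ /negP[]]; apply/eqP/rowP => i.
  by have := ltn_ord i; rewrite [X in (_ < X)%N]d0.
have dR0 : 0 < d%:R :> R by rewrite ltr0n.
have trPd : \tr P = d%:R.
  by rewrite /mxtrace (eq_bigr (fun=> 1)) ?sumr_const ?card_ord.
pose l i := (a i)^-1.
have sl : \sum_i l i = d%:R by rewrite -trP.
have sum1 (c : R) : \sum_(i < d) c = d%:R * c by rewrite sumr_const card_ord mulr_natl.
(* The inverse eigenvalues average to 1 and are at most 1 / lmin. Together with [m1] this places 1
   where the two logarithm bounds require it. *)
have M1 : 1 <= lmin^-1.
  rewrite -(ler_pM2l dR0) mulr1 -{1}sl -sum1; apply: ler_sum => i _.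
  by rewrite lef_pV2 ?posrE// lemin.
have m1 : lmax^-1 <= 1.
  rewrite -(ler_pM2l dR0) mulr1 -sum1 -[leRHS]sl; apply: ler_sum => i _.
  by rewrite lef_pV2 ?posrE// lemax.
pose L := ln (\det S); pose s2 := \tr (P *m P).
have LE : L <= (s2 - d%:R) / (2 * lmax^-1 ^+ 2).
  have -> : L = - \sum_i ln (l i).
    rewrite /L; have -> : \det S = expR (- \sum_i ln (l i)); last by rewrite expRK.
    rewrite detS -sumrN expR_sum; apply: eq_bigr => i _.
    by rewrite lnV ?posrE// opprK lnK ?posrE.
  rewrite -sumrN.
  have -> : (s2 - d%:R) / (2 * lmax^-1 ^+ 2) =
      \sum_i - (l i - 1 - (l i - 1) ^+ 2 / (2 * lmax^-1 ^+ 2)).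
    rewrite sumrN sumrB sumrB sl sum1 mulr1 subrr sub0r opprK -mulr_suml.
    congr (_ / _); transitivity (\sum_i (l i ^+ 2 - 2 * l i + 1)).
      by rewrite big_split /= sumrB -mulr_sumr sl sum1 /s2 trPP; ring.
    by apply: eq_bigr => i _; ring.
  apply: ler_sum => i _; rewrite lerN2; apply: ln_ge_quad; rewrite ?invr_gt0//.
  by rewrite lef_pV2 ?posrE// lemax.
(* [c1] is half the coefficient 1 / (2 M^2) of [ln_le_quad] at M = 1 / lmin; [c0] absorbs the d in
   sum_i (A_ii - 1)^2 = [diag_sqr] - d. *)
pose c1 : R := (4 * lmin^-1 ^+ 2)^-1.
pose c0 : R := 2^-1 * L + c1 * d%:R.
pose O := [set M : MxSpace R d | orthogonal_mx M].
have mO : measurable O := @measurable_orthogonal R d.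
have infE (Q : MxSpace R d) : O Q ->
    (ereal_inf [set KL q (gauss_density (Q *m S *m Q^T)) | q in @Pprod R d] <=
     (c0 - c1 * diag_sqr P Q)%:E)%E.
  move=> oQ; apply: le_trans (inf_KL_rotated_gauss spdS oQ) _; rewrite lee_fin -/P -/L.
  have -> : c0 - c1 * diag_sqr P Q = 2^-1 * (L + \sum_i (conj_mx P Q i i - 1
      - (conj_mx P Q i i - 1) ^+ 2 / (2 * lmin^-1 ^+ 2))).
    have trA := conj_mx_trace P oQ; rewrite trPd /mxtrace in trA.
    rewrite !sumrB trA sum1 mulr1 subrr sub0r -mulr_suml.
    have -> : \sum_i (conj_mx P Q i i - 1) ^+ 2 = diag_sqr P Q - d%:R.
      transitivity (\sum_i (conj_mx P Q i i ^+ 2 - 2 * conj_mx P Q i i + 1)).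
        by apply: eq_bigr => i _; ring.
      by rewrite big_split /= sumrB -mulr_sumr trA sum1 -/(diag_sqr P Q); ring.
    by rewrite /c0 /c1; field; rewrite gt_eqF.
  rewrite ler_wpM2l ?invr_ge0// lerD2l; apply: ler_sum => i _.
  rewrite -/(conj_mx P Q); apply: ln_le_quad => //.
    exact: orthogonal_conj_invmx_gt0.
  (* A_ii is the quadratic form of the inverse of [S] at a unit vector, row [i] of [Q], hence at
     most 1 / lmin. *)
  have := bnd (row i Q) lmin lmin0 (fun i => lemin _ (eva i)).
  rewrite -/(bil P _ _) -conj_mxE => /le_trans; apply.
  have -> : (row i Q *m (row i Q)^T) 0 0 = 1; last by rewrite mulr1.
  have := conj_mxE 1%:M Q i i; rewrite /bil !mulmx1 => <-.
  by rewrite oQ mxE eqxx.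
(* The integral in the goal runs over all matrices, so [diag_sqr] is extended by 0 off the
   orthogonal ones, which form a set of full measure. *)
pose D := (fun M : MxSpace R d => (diag_sqr P M)%:E) \_ O.
have iD : mu.-integrable setT D.
  exact: (proj1 (integrable_mkcond _ mO) (integrable_diag_sqr haar symP)).
have ic0 : mu.-integrable setT (EFin \o cst c0).
  exact: finite_measure_integrable_cst.
have ic1 := integrableZl measurableT c1 iD.
pose g M := ((EFin \o cst c0) M - c1%:E * D M)%E.
have mg : measurable_fun setT g.
  by have /integrableP[] := integrableB measurableT ic0 ic1.
have muOC : mu (~` O) = 0%E.
  by rewrite probability_setC// haar.1 subee.
apply: le_trans (le_integral_ae_nonmeasurable mO muOC mg _) _.
  by move=> Q oQ; apply: le_trans (infE Q oQ) _; rewrite /g /D patchE mem_set.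
rewrite /g integralB// integralZl// -integral_mkcond haar_diag_sqr//.
rewrite gauss_density1 KL_normal_prod_gauss ?sym_pos_def_det_gt0//.
rewrite -/P -/L trPd.
have -> : \sum_i P i i * 1 ^+ 2 = d%:R.
  by rewrite (eq_bigr (fun=> 1)) ?sum1 ?mulr1// => i _; rewrite P1 expr1n mulr1.
have -> : \sum_(i < d) ln (1 ^+ 2 : R) = 0 by rewrite expr1n ln1 big1_eq.
have -> : (\int[mu]_x (EFin \o cst c0) x = c0%:E)%E.
  apply: etrans (integral_cst mu measurableT c0%:E) _.
  by rewrite -[RHS]mule1; congr (_ * _)%E; exact: (probability_setT mu).
rewrite -!EFinM -EFinB lee_fin -/s2 /c0 /c1.
have d2 : 0 < d%:R + 2 :> R by rewrite ltr_wpDl.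
rewrite -subr_ge0.
(* The gap between the two sides is a nonnegative multiple of the slack in [LE]. *)
have -> : (1 - 2 / ((d%:R + 2) * (lmax / lmin) ^+ 2)) * (2^-1 * (L - 0 + d%:R - d%:R)) -
  (2^-1 * L + (4 * lmin^-1 ^+ 2)^-1 * d%:R -
    (4 * lmin^-1 ^+ 2)^-1 * ((d%:R ^+ 2 + 2 * s2) / (d%:R + 2))) =
  lmin ^+ 2 / (d%:R + 2) / lmax ^+ 2 * ((s2 - d%:R) / (2 * lmax^-1 ^+ 2) - L).
  by field; rewrite !gt_eqF.
apply: mulr_ge0; last by rewrite subr_ge0.
by apply: mulr_ge0; [apply: mulr_ge0|]; rewrite ?invr_ge0 ?sqr_ge0 ?(ltW d2).
Qed.
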